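(* Let $\alpha$ be a peak composition of $n$. Then $$\widetilde{ch}([\widetilde{\mathbf{N}}_{\mathsf{SPCT}(\alpha)}])=\widetilde{Q}_\alpha,$$ where $\widetilde{Q}_\alpha$ is the quasisymmetric Schur $Q$-function indexed by $\alpha$.
   Context: Compositions. A composition $\alpha=(\alpha_1,\dots,\alpha_k)\vDash n$ is a sequence of positive integers with sum $n$; $\mathrm{Des}(\alpha)=\{\alpha_1,\alpha_1+\alpha_2,\dots,\alpha_1+\cdots+\alpha_{k-1}\}\subseteq [n-1]$, where $[m]=\{1,\dots,m\}$; $\mathrm{comp}_n(X)$ is the composition of $n$ with descent set $X\subseteq[n-1]$. For a set $X$ of positive integers, $\mathrm{Peak}(X)=\{i\in X: i>1,\ i-1\notin X\}$; $\mathrm{Peak}(\alpha)=\mathrm{Peak}(\mathrm{Des}(\alpha))$. A peak composition is a composition all of whose parts, except possibly the last, are greater than $1$. Functions. For $\alpha\vDash n$, $F_\alpha=\sum x_{i_1}\cdots x_{i_n}$ over positive integers $i_1\le\cdots\le i_n$ with $i_j<i_{j+1}$ whenever $j\in\mathrm{Des}(\alpha)$. For a peak composition $\alpha\vDash n$, $K_\alpha=2^{|\mathrm{Peak}(\alpha)|+1}\sum_\beta F_\beta$, sum over $\beta\vDash n$ with $\mathrm{Peak}(\alpha)\subseteq \mathrm{Des}(\beta)\triangle(\mathrm{Des}(\beta)+1)$ ($X+1=\{x+1:x\in X\}$). The peak algebra $\mathsf{Peak}$ has basis the functions $K_\alpha$. Algebras. $H_n(0)$ is the $\mathbb{C}$-algebra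 with generators $\pi_1,\dots,\pi_{n-1}$ and relations $\pi_i^2=-\pi_i$, $\pi_i\pi_j=\pi_j\pi_i$ for $|i-j|\ge2$, $\pi_i\pi_{i+1}\pi_i=\pi_{i+1}\pi_i\pi_{i+1}$. $HCl_n(0)$ is generated by $\pi_1,\dots,\pi_{n-1}$ (with these relations) and $c_1,\dots,c_n$ with $c_i^2=-1$, $c_ic_j=-c_jc_i$ for $i\ne j$, and $\pi_ic_j=c_j\pi_i$ for $j\ne i,i+1$, $\pi_ic_i=c_{i+1}\pi_i$, $(\pi_i+1)c_{i+1}=c_i(\pi_i+1)$. It is a superalgebra with $\pi_i$ of degree $0$, $c_j$ of degree $1$. Characteristic. For $\alpha\vDash n$, $\mathbf{F}_\alpha=\mathbb{C}v_\alpha$ is the simple $H_n(0)$-module with $\pi_iv_\alpha=-v_\alpha$ if $i\in\mathrm{Des}(\alpha)$ and $0$ otherwise, and $\mathbf{M}_\alpha$ is the $HCl_n(0)$-supermodule induced from $\mathbf{F}_\alpha$. The peak characteristic $\widetilde{ch}$ is the isomorphism of Bergeron, Hivert and Thibon from $\bigoplus_n\mathcal{G}_0(HCl_n(0))$ (Grothendieck groups of finite-dimensional supermodules) to $\mathsf{Peak}$, which satisfies $\widetilde{ch}([\mathbf{M}_\alpha])=K_{\mathrm{comp}_n(\mathrm{Peak}(\alpha))}$ for $\alpha\vDash n$. Diagram modules. Let $D$ be a diagram of $n$ boxes with a reading order (a total order on the boxes). A standard filling is a bijective assignment of $1,\dots,n$ to the boxes; $\mathrm{rw}(T)$ is the permutation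 given by the entries of $T$ in reading order from left to right; $s_iT$ exchanges the entries $i,i+1$ of $T$. For a nonempty set $\mathcal{T}$ of standard fillings and $T\in\mathcal{T}$, $\mathrm{Des}(T)$ is the set of $i\in[n-1]$ with $i$ to the right of $i+1$ in $\mathrm{rw}(T)$, and $\mathrm{Peak}(T)=\mathrm{Peak}(\mathrm{Des}(T))$. Elements of $[n-1]\setminus\mathrm{Des}(T)$ are ascents; an ascent $i$ is attacking if $s_iT\notin\mathcal{T}$ and nonattacking otherwise. $T$ has an ascent in positions $(r,s)$ if $r<s$ and $\mathrm{rw}(T)_s-\mathrm{rw}(T)_r=1$. $\mathcal{T}$ is ascent-compatible if whenever $T,T'\in\mathcal{T}$ both have an ascent in positions $(r,s)$, it is attacking in $T$ if and only if it is attacking in $T'$. In that case $\mathbf{N}_{\mathcal{T}}$ is the $H_n(0)$-module on the $\mathbb{C}$-span of $\mathcal{T}$ with $\pi_iT=-T$ if $i\in\mathrm{Des}(T)$, $0$ if $i$ is an attacking ascent, $s_iT$ if $i$ is a nonattacking ascent; and $\widetilde{\mathbf{N}}_{\mathcal{T}}=\mathrm{Ind}_{H_n(0)}^{HCl_n(0)}\mathbf{N}_{\mathcal{T}}$. Tableaux. $D(\alpha)$ is the left-justified array with $\alpha_i$ boxes in row $i$, rows numbered from bottom to top. For a peak composition $\alpha\vDash n$, $\mathsf{SPCT}(\alpha)$ (standard peak composition tableaux) is the set of standard fillings of $D(\alpha)$ such that: (SPCT1) entries increase from left to right along each row; (SPCT2) entries increase from bottom to top in the first column; (SPCT3) for every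 $1\le k\le n$, the boxes with entries at most $k$ form the diagram of a peak composition. The reading order reads columns from bottom to top, starting with the leftmost column and proceeding rightwards. $\mathsf{SPCT}(\alpha)$ is ascent-compatible for this reading order, so $\widetilde{\mathbf{N}}_{\mathsf{SPCT}(\alpha)}$ is defined. The quasisymmetric Schur $Q$-function is $\widetilde{Q}_\alpha=\sum_{T\in\mathsf{SPCT}(\alpha)}K_{\mathrm{comp}_n(\mathrm{Peak}(T))}$. *)

(* Defs.v *)
From HB Require Import structures.
From mathcomp Require Import all_boot all_order all_algebra all_fingroup.
From mathcomp Require Import generic_quotient.
From mathcomp Require Import boolp functions reals.
From mathcomp Require Import finmap multiset complex zify.

Set Implicit Arguments.
Unset Strict Implicit.
Unset Printing Implicit Defensive.

Import GRing.Theory.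
Local Open Scope ring_scope.
Local Open Scope quotient_scope.

Section Quotient.
Variables (T : Type) (E : T -> T -> Prop).
Hypotheses (Erefl : forall x, E x x) (Esym : forall x y, E x y -> E y x).
Hypothesis Etrans : forall y x z, E x y -> E y z -> E x z.

Definition brel : rel {classic T} := fun x y => `[< E x y >].

Lemma brel_refl : reflexive brel. Proof. by move=> x; apply/asboolP. Qed.
Lemma brel_sym : symmetric brel.
Proof. by move=> x y; apply/idP/idP => /asboolP h; apply/asboolP/Esym. Qed.
Lemma brel_trans : transitive brel.
Proof.
by move=> y x z /asboolP h /asboolP h'; apply/asboolP; exact: Etrans h h'.
Qed.

Definition ebrel := EquivRel brel brel_refl brel_sym brel_trans.
Definition quot := {eq_quot ebrel}.
Definition qpi (x : T) : quot := \pi_{eq_quot ebrel} x.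
Definition qrepr (x : quot) : T := repr x.

Lemma qreprK x : qpi (qrepr x) = x. Proof. exact: reprK. Qed.
Lemma qpiP x y : qpi x = qpi y <-> E x y.
Proof.
split; first by move=> /eqmodP /asboolP.
by move=> h; apply/eqmodP/asboolP.
Qed.
Lemma qrepr_pi x : E (qrepr (qpi x)) x.
Proof. by apply/qpiP; rewrite qreprK. Qed.
End Quotient.

(* The K-algebra with generators X and relations R: noncommutative polynomial
   expressions modulo the least congruence containing R and the axioms of a
   K-algebra. It may be trivial, hence a pzRingType; its K-algebra structure is
   the central morphism pconst. *)
Section PresentedAlgebra.
Variables (K : comNzRingType) (X : Type).

Inductive aterm :=
  | AGen of X | AConst of K | AAdd of aterm & aterm | AMul of aterm & aterm.

Variable R : aterm -> aterm -> Prop.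

Inductive acong : aterm -> aterm -> Prop :=
  | acong_rel s t : R s t -> acong s t
  | acong_refl s : acong s s
  | acong_sym s t : acong s t -> acong t s
  | acong_trans t s u : acong s t -> acong t u -> acong s u
  | acong_add s s' t t' :
      acong s s' -> acong t t' -> acong (AAdd s t) (AAdd s' t')
  | acong_mul s s' t t' :
      acong s s' -> acong t t' -> acong (AMul s t) (AMul s' t')
  | acong_addA s t u : acong (AAdd s (AAdd t u)) (AAdd (AAdd s t) u)
  | acong_addC s t : acong (AAdd s t) (AAdd t s)
  | acong_add0 s : acong (AAdd (AConst 0) s) s
  | acong_addN s : acong (AAdd (AMul (AConst (-1)) s) s) (AConst 0)
  | acong_mulA s t u : acong (AMul s (AMul t u)) (AMul (AMul s t) u)
  | acong_mul1 s : acong (AMul (AConst 1) s) s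
  | acong_mulDl s t u :
      acong (AMul (AAdd s t) u) (AAdd (AMul s u) (AMul t u))
  | acong_mulDr s t u :
      acong (AMul s (AAdd t u)) (AAdd (AMul s t) (AMul s u))
  | acong_constD a b : acong (AConst (a + b)) (AAdd (AConst a) (AConst b))
  | acong_constM a b : acong (AConst (a * b)) (AMul (AConst a) (AConst b))
  | acong_constC a s : acong (AMul (AConst a) s) (AMul s (AConst a)).

Definition palg := quot acong_refl acong_sym acong_trans.
HB.instance Definition _ := Choice.on palg.

Local Notation pi := (qpi acong_refl acong_sym acong_trans).
Local Notation rp := (@qrepr _ _ acong_refl acong_sym acong_trans).

Definition pgen (x : X) : palg := pi (AGen x).
Definition pconst (a : K) : palg := pi (AConst a).
Definition padd (x y : palg) : palg := pi (AAdd (rp x) (rp y)).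
Definition pmul (x y : palg) : palg := pi (AMul (rp x) (rp y)).
Definition popp (x : palg) : palg := pi (AMul (AConst (-1)) (rp x)).

Lemma pi_eq s t : acong s t -> pi s = pi t. Proof. by move=> h; apply/qpiP. Qed.
Lemma rp_pi s : acong s (rp (pi s)).
Proof. by apply: acong_sym; apply: qrepr_pi. Qed.
Lemma piD s t : pi (AAdd s t) = padd (pi s) (pi t).
Proof. by apply: pi_eq; apply: acong_add; apply: rp_pi. Qed.
Lemma piM s t : pi (AMul s t) = pmul (pi s) (pi t).
Proof. by apply: pi_eq; apply: acong_mul; apply: rp_pi. Qed.
Lemma poppE x : popp x = pmul (pconst (-1)) x.
Proof. by rewrite -[x in RHS](@qreprK _ _ acong_refl acong_sym acong_trans) -piM. Qed.
Lemma palgP (P : palg -> Prop) : (forall t, P (pi t)) -> forall x, P x.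
Proof. by move=> h x; rewrite -[x](@qreprK _ _ acong_refl acong_sym acong_trans). Qed.

Lemma paddA : associative padd.
Proof.
elim/palgP=> s; elim/palgP=> t; elim/palgP=> u; rewrite -!piD.
apply: pi_eq; exact: acong_addA.
Qed.
Lemma paddC : commutative padd.
Proof.
elim/palgP=> s; elim/palgP=> t; rewrite -!piD; apply: pi_eq; exact: acong_addC.
Qed.
Lemma padd0 : left_id (pconst 0) padd.
Proof. elim/palgP=> s; rewrite -!piD; apply: pi_eq; exact: acong_add0. Qed.
Lemma paddN : left_inverse (pconst 0) popp padd.
Proof. elim/palgP=> s; rewrite poppE -!piM -piD; apply: pi_eq; exact: acong_addN. Qed.
HB.instance Definition _ :=
  GRing.isZmodule.Build palg paddA paddC padd0 paddN.

Lemma pmulA : associative pmul.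
Proof.
elim/palgP=> s; elim/palgP=> t; elim/palgP=> u; rewrite -!piM.
apply: pi_eq; exact: acong_mulA.
Qed.
Lemma pmul1 : left_id (pconst 1) pmul.
Proof. elim/palgP=> s; rewrite -!piM; apply: pi_eq; exact: acong_mul1. Qed.
Lemma pconstC a x : pmul (pconst a) x = pmul x (pconst a).
Proof. elim/palgP: x => s; rewrite -!piM; apply: pi_eq; exact: acong_constC. Qed.
Lemma pmulr1 : right_id (pconst 1) pmul.
Proof. by move=> x; rewrite -pconstC pmul1. Qed.
Lemma pmulDl : left_distributive pmul padd.
Proof.
elim/palgP=> s; elim/palgP=> t; elim/palgP=> u; rewrite -!(piM, piD).
apply: pi_eq; exact: acong_mulDl.
Qed.
Lemma pmulDr : right_distributive pmul padd.
Proof.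
elim/palgP=> s; elim/palgP=> t; elim/palgP=> u; rewrite -!(piM, piD).
apply: pi_eq; exact: acong_mulDr.
Qed.
HB.instance Definition _ := GRing.Zmodule_isPzRing.Build palg
  pmulA pmul1 pmulr1 pmulDl pmulDr.

Lemma pconst_is_zmod_morphism : zmod_morphism pconst.
Proof.
move=> a b; rewrite [RHS](_ : _ = padd (pconst a) (popp (pconst b))) //.
rewrite poppE -piM -piD; apply: pi_eq; apply: acong_trans (acong_constD _ _) _.
apply: acong_add; first exact: acong_refl.
by rewrite -[- b]mulN1r; apply: acong_constM.
Qed.
Lemma pconst_is_monoid_morphism : monoid_morphism pconst.
Proof. by split=> // a b; rewrite [RHS](_ : _ = pmul (pi (AConst a)) (pi (AConst b))) // -piM; apply: pi_eq; apply: acong_constM. Qed.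
HB.instance Definition _ :=
  GRing.isZmodMorphism.Build K palg pconst pconst_is_zmod_morphism.
HB.instance Definition _ :=
  GRing.isMonoidMorphism.Build K palg pconst pconst_is_monoid_morphism.

Lemma palg_rel s t : R s t -> pi s = pi t.
Proof. by move=> h; apply: pi_eq; apply: acong_rel. Qed.

Section Lift.
Variables (A : pzRingType) (iota : {rmorphism K -> A}) (g : X -> A).

Fixpoint aeval (t : aterm) : A :=
  match t with
  | AGen x => g x
  | AConst a => iota a
  | AAdd s t => aeval s + aeval t
  | AMul s t => aeval s * aeval t
  end.

Hypothesis central : forall a x, iota a * x = x * iota a.
Hypothesis sound : forall s t, R s t -> aeval s = aeval t.

Lemma aeval_cong s t : acong s t -> aeval s = aeval t.
Proof.
elim=> {s t} //=.
- by move=> t s u _ -> _ ->.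
- by move=> s s' t t' _ -> _ ->.
- by move=> s s' t t' _ -> _ ->.
- by move=> *; rewrite addrA.
- by move=> *; rewrite addrC.
- by move=> *; rewrite rmorph0 add0r.
- by move=> *; rewrite rmorphN rmorph1 rmorph0 mulN1r addNr.
- by move=> *; rewrite mulrA.
- by move=> *; rewrite rmorph1 mul1r.
- by move=> *; rewrite mulrDl.
- by move=> *; rewrite mulrDr.
- by move=> *; rewrite rmorphD.
- by move=> *; rewrite rmorphM.
Qed.

Definition plift (x : palg) : A := aeval (rp x).

Lemma plift_pi t : plift (pi t) = aeval t.
Proof. by apply: aeval_cong; apply: qrepr_pi. Qed.
Lemma plift_gen x : plift (pgen x) = g x. Proof. exact: plift_pi. Qed.
Lemma plift_const a : plift (pconst a) = iota a. Proof. exact: plift_pi. Qed.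

Lemma plift_is_zmod_morphism : zmod_morphism plift.
Proof.
elim/palgP=> s; elim/palgP=> t.
rewrite [_ - _](_ : _ = padd (pi s) (popp (pi t))) // poppE -piM -piD.
by rewrite !plift_pi /= rmorphN rmorph1 mulN1r.
Qed.
Lemma plift_is_monoid_morphism : monoid_morphism plift.
Proof.
split; first by rewrite plift_const rmorph1.
by elim/palgP=> s; elim/palgP=> t; rewrite [_ * _ in LHS](_ : _ = pmul (pi s) (pi t)) // -piM !plift_pi.
Qed.
Definition plift_rmorphism : {rmorphism palg -> A} :=
  HB.pack plift
    (GRing.isZmodMorphism.Build palg A plift plift_is_zmod_morphism)
    (GRing.isMonoidMorphism.Build palg A plift plift_is_monoid_morphism).
End Lift.
End PresentedAlgebra.

(* The left A-module with generators X and relations R. *)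
Section PresentedModule.
Variables (A : pzRingType) (X : Type).

Inductive mterm :=
  | MGen of X | MZero | MAdd of mterm & mterm | MScale of A & mterm.

Variable R : mterm -> mterm -> Prop.

Inductive mcong : mterm -> mterm -> Prop :=
  | mcong_rel s t : R s t -> mcong s t
  | mcong_refl s : mcong s s
  | mcong_sym s t : mcong s t -> mcong t s
  | mcong_trans t s u : mcong s t -> mcong t u -> mcong s u
  | mcong_add s s' t t' :
      mcong s s' -> mcong t t' -> mcong (MAdd s t) (MAdd s' t')
  | mcong_scale a s s' : mcong s s' -> mcong (MScale a s) (MScale a s')
  | mcong_addA s t u : mcong (MAdd s (MAdd t u)) (MAdd (MAdd s t) u)
  | mcong_addC s t : mcong (MAdd s t) (MAdd t s)
  | mcong_add0 s : mcong (MAdd MZero s) s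
  | mcong_scale0 s : mcong (MScale 0 s) MZero
  | mcong_scale1 s : mcong (MScale 1 s) s
  | mcong_scaleA a b s : mcong (MScale a (MScale b s)) (MScale (a * b) s)
  | mcong_scaleDr a s t :
      mcong (MScale a (MAdd s t)) (MAdd (MScale a s) (MScale a t))
  | mcong_scaleDl a b s :
      mcong (MScale (a + b) s) (MAdd (MScale a s) (MScale b s)).

Definition pmod := quot mcong_refl mcong_sym mcong_trans.
HB.instance Definition _ := Choice.on pmod.

Local Notation pi := (qpi mcong_refl mcong_sym mcong_trans).
Local Notation rp := (@qrepr _ _ mcong_refl mcong_sym mcong_trans).

Definition mgen (x : X) : pmod := pi (MGen x).
Definition madd (x y : pmod) : pmod := pi (MAdd (rp x) (rp y)).
Definition mscale (a : A) (x : pmod) : pmod := pi (MScale a (rp x)).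
Definition mopp (x : pmod) : pmod := mscale (-1) x.

Lemma mpi_eq s t : mcong s t -> pi s = pi t. Proof. by move=> h; apply/qpiP. Qed.
Lemma mrp_pi s : mcong s (rp (pi s)).
Proof. by apply: mcong_sym; apply: qrepr_pi. Qed.
Lemma mpiD s t : pi (MAdd s t) = madd (pi s) (pi t).
Proof. by apply: mpi_eq; apply: mcong_add; apply: mrp_pi. Qed.
Lemma mpiZ a s : pi (MScale a s) = mscale a (pi s).
Proof. by apply: mpi_eq; apply: mcong_scale; apply: mrp_pi. Qed.
Lemma pmodP (P : pmod -> Prop) : (forall t, P (pi t)) -> forall x, P x.
Proof. by move=> h x; rewrite -[x](@qreprK _ _ mcong_refl mcong_sym mcong_trans). Qed.

Lemma maddA : associative madd.
Proof.
elim/pmodP=> s; elim/pmodP=> t; elim/pmodP=> u; rewrite -!mpiD.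
apply: mpi_eq; exact: mcong_addA.
Qed.
Lemma maddC : commutative madd.
Proof.
elim/pmodP=> s; elim/pmodP=> t; rewrite -!mpiD; apply: mpi_eq; exact: mcong_addC.
Qed.
Lemma madd0 : left_id (pi MZero) madd.
Proof. elim/pmodP=> s; rewrite -!mpiD; apply: mpi_eq; exact: mcong_add0. Qed.
Lemma mscale1 : left_id 1 mscale.
Proof. elim/pmodP=> s; rewrite -!mpiZ; apply: mpi_eq; exact: mcong_scale1. Qed.
Lemma mscaleDl v : {morph mscale^~ v : a b / a + b >-> madd a b}.
Proof.
move=> a b; elim/pmodP: v => s; rewrite -!(mpiZ, mpiD).
apply: mpi_eq; exact: mcong_scaleDl.
Qed.
Lemma mscale0 x : mscale 0 x = pi MZero.
Proof. elim/pmodP: x => s; rewrite -mpiZ; apply: mpi_eq; exact: mcong_scale0. Qed.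
Lemma maddN : left_inverse (pi MZero) mopp madd.
Proof.
by move=> x; rewrite /mopp -{2}[x]mscale1 -mscaleDl addNr mscale0.
Qed.
HB.instance Definition _ :=
  GRing.isZmodule.Build pmod maddA maddC madd0 maddN.

Lemma mscaleA a b v : mscale a (mscale b v) = mscale (a * b) v.
Proof. elim/pmodP: v => s; rewrite -!mpiZ; apply: mpi_eq; exact: mcong_scaleA. Qed.
Lemma mscaleDr : right_distributive mscale +%R.
Proof.
move=> a; elim/pmodP=> s; elim/pmodP=> t; rewrite [LHS](_ : _ = mscale a (madd (pi s) (pi t))) //.
rewrite [RHS](_ : _ = madd (mscale a (pi s)) (mscale a (pi t))) //.
rewrite -!(mpiZ, mpiD); apply: mpi_eq; exact: mcong_scaleDr.
Qed.
HB.instance Definition _ := GRing.Zmodule_isLmodule.Build A pmod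
  mscaleA mscale1 mscaleDr mscaleDl.
End PresentedModule.

(* Compositions and the subsets of [n-1] attached to them are sequences of
   natural numbers. *)

Definition is_comp (n : nat) (a : seq nat) : bool :=
  all (leq 1) a && (sumn a == n).

Definition is_peak_comp (n : nat) (a : seq nat) : bool :=
  is_comp n a && all (leq 2) (take (size a).-1 a).

Definition Des (a : seq nat) : seq nat :=
  [seq sumn (take i a) | i <- iota 1 (size a).-1].

(* The composition of n with descent set X: the successive differences of
   0 and the elements of (X \cap [n-1]) \cup {n}. *)
Definition comp_of_set (n : nat) (X : seq nat) : seq nat :=
  pairmap (fun x y => y - x)%N 0%N
    [seq i <- iota 1 n | (i \in X) || (i == n)].

Definition Peak (X : seq nat) : seq nat :=
  [seq i <- X | (1 < i)%N && (i.-1 \notin X)].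

Section Functions.
Variable K : comNzRingType.

(* A formal power series in x_1, x_2, ... maps a monomial, i.e. the multiset
   of the indices of its variables, to its coefficient. *)
Definition fps := ({mset nat}%mset) -> K^o.
HB.instance Definition _ :=
  GRing.Lmodule.copy fps (({mset nat}%mset) -> K^o).

(* i_1 <= ... <= i_n is determined by its multiset, so the coefficients of
   F_alpha are 0 and 1. *)
Definition F_index (a : seq nat) (i : seq nat) : Prop :=
  [/\ size i = sumn a, all (leq 1) i, sorted leq i &
      forall j, j \in Des a -> (nth 0%N i j.-1 < nth 0%N i j)%N].

Definition F (a : seq nat) : fps :=
  fun m => (`[< exists2 i, F_index a i & seq_mset i = m >] : bool)%:R.

(* The compositions of n have at most n parts, all at most n. *)
Definition Kfun (n : nat) (a : seq nat) : fps :=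
  (2 ^+ (size (Peak (Des a))).+1 : K) *:
  \sum_(b : n.-bseq 'I_n.+1 |
          let b' := map (@nat_of_ord _) b in
          is_comp n b' &&
          all (fun i => (i \in Des b') (+) (i \in map succn (Des b')))
              (Peak (Des a)))
     F (map (@nat_of_ord _) b).

Definition in_Peak_algebra (f : fps) : Prop :=
  exists s : seq (K * (nat * seq nat)),
    all (fun t => is_peak_comp t.2.1 t.2.2) s /\
    f = \sum_(t <- s) t.1 *: Kfun t.2.1 t.2.2.

End Functions.

(* i : 'I_n.-1 stands for the index i+1 of pi_(i+1), and j : 'I_n for the
   index j+1 of c_(j+1); lo i and hi i stand for i+1 and i+2. *)

Lemma hi_subproof n (i : 'I_n.-1) : (i.+1 < n)%N.
Proof. by case: i => i /=; rewrite ltn_predRL. Qed.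

Definition hi n (i : 'I_n.-1) : 'I_n := Ordinal (hi_subproof i).
Definition lo n (i : 'I_n.-1) : 'I_n := Ordinal (ltnW (hi_subproof i)).

Section Algebras.
Variables (K : comNzRingType) (n : nat).

Inductive hecke_rel (X : Type) (p : 'I_n.-1 -> aterm K X) :
    aterm K X -> aterm K X -> Prop :=
  | hecke_quad i : hecke_rel p (AMul (p i) (p i)) (AMul (AConst X (-1)) (p i))
  | hecke_comm (i j : 'I_n.-1) : (i.+1 < j)%N || (j.+1 < i)%N ->
      hecke_rel p (AMul (p i) (p j)) (AMul (p j) (p i))
  | hecke_braid (i j : 'I_n.-1) : j = i.+1 :> nat ->
      hecke_rel p (AMul (AMul (p i) (p j)) (p i))
                  (AMul (AMul (p j) (p i)) (p j)).

Definition H0 := palg (hecke_rel (AGen K (X := 'I_n.-1))).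
HB.instance Definition _ := GRing.PzRing.on H0.

Let p i : aterm K ('I_n.-1 + 'I_n) := AGen K (inl i).
Let c j : aterm K ('I_n.-1 + 'I_n) := AGen K (inr j).
Let one : aterm K ('I_n.-1 + 'I_n) := AConst _ 1.

Inductive HCl_rel :
    aterm K ('I_n.-1 + 'I_n) -> aterm K ('I_n.-1 + 'I_n) -> Prop :=
  | HCl_hecke s t : hecke_rel p s t -> HCl_rel s t
  | HCl_sq j : HCl_rel (AMul (c j) (c j)) (AConst _ (-1))
  | HCl_anti i j : i != j ->
      HCl_rel (AMul (c i) (c j)) (AMul (AConst _ (-1)) (AMul (c j) (c i)))
  | HCl_comm i j : j != lo i -> j != hi i ->
      HCl_rel (AMul (p i) (c j)) (AMul (c j) (p i))
  | HCl_lo i : HCl_rel (AMul (p i) (c (lo i))) (AMul (c (hi i)) (p i))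
  | HCl_hi i : HCl_rel (AMul (AAdd (p i) one) (c (hi i)))
                       (AMul (c (lo i)) (AAdd (p i) one)).

Definition HCl := palg HCl_rel.
HB.instance Definition _ := GRing.PzRing.on HCl.

Definition hpi (i : 'I_n.-1) : HCl := pgen HCl_rel (inl i).
Definition hc (j : 'I_n) : HCl := pgen HCl_rel (inr j).
Definition hk : {rmorphism K -> HCl} := pconst HCl_rel.

(* homog e is the part of degree e of the superalgebra HCl. *)
Inductive homog : bool -> HCl -> Prop :=
  | homog_const a : homog false (hk a)
  | homog_pi i : homog false (hpi i)
  | homog_c j : homog true (hc j)
  | homog_add e x y : homog e x -> homog e y -> homog e (x + y)
  | homog_mul e e' x y : homog e x -> homog e' y -> homog (e (+) e') (x * y).

Lemma H0_HCl_sound s t : hecke_rel (AGen K (X := 'I_n.-1)) s t ->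
  aeval hk hpi s = aeval hk hpi t.
Proof.
case=> [i|i j h|i j h] /=.
- by have := palg_rel (HCl_hecke (hecke_quad p i)); rewrite !piM.
- by have := palg_rel (HCl_hecke (hecke_comm p h)); rewrite !piM.
- by have := palg_rel (HCl_hecke (hecke_braid p h)); rewrite !piM.
Qed.

Definition H0_HCl : {rmorphism H0 -> HCl} :=
  plift_rmorphism (@pconstC _ _ HCl_rel) H0_HCl_sound.

Definition H0_relations d (P : 'I_n.-1 -> 'M[K]_d) : Prop :=
  [/\ forall i, P i * P i = - P i,
      forall i j : 'I_n.-1, (i.+1 < j)%N || (j.+1 < i)%N ->
        P i * P j = P j * P i
    & forall i j : 'I_n.-1, j = i.+1 :> nat ->
        P i * P j * P i = P j * P i * P j].

Lemma scalar_mx_central d (a : K) (x : 'M_d) : a%:M * x = x * a%:M.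
Proof. exact/esym/scalar_mxC. Qed.

Lemma H0_rep_sound d (P : 'I_n.-1 -> 'M[K]_d) : H0_relations P ->
  forall s t, hecke_rel (AGen K (X := 'I_n.-1)) s t ->
    aeval (scalar_mx : {rmorphism K -> 'M_d}) P s = aeval (scalar_mx : {rmorphism K -> 'M_d}) P t.
Proof.
case=> h1 h2 h3 s t [i|i j h|i j h] /=.
- by rewrite h1 rmorphN rmorph1 mulN1r.
- exact: h2.
- exact: h3.
Qed.

Definition H0_rep d (P : 'I_n.-1 -> 'M[K]_d) (hP : H0_relations P) :
    {rmorphism H0 -> 'M[K]_d} :=
  plift_rmorphism (@scalar_mx_central d) (H0_rep_sound hP).

End Algebras.

Section MatrixModule.
Variables (K : comNzRingType) (A : pzRingType) (d : nat).
Variable rho : {rmorphism A -> 'M[K]_d}.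

Definition mxmod (_ : {rmorphism A -> 'M[K]_d}) := 'cV[K]_d.
Local Notation V := (mxmod rho).
HB.instance Definition _ := GRing.Zmodule.on V.

Definition mxact (a : A) (v : V) : V := rho a *m v.

Lemma mxactA a b v : mxact a (mxact b v) = mxact (a * b) v.
Proof. by rewrite /mxact rmorphM mulmxA. Qed.
Lemma mxact1 : left_id 1 mxact.
Proof. by move=> v; rewrite /mxact rmorph1 mul1mx. Qed.
Lemma mxactDr : right_distributive mxact +%R.
Proof. by move=> a u v; rewrite /mxact mulmxDr. Qed.
Lemma mxactDl v : {morph mxact^~ v : a b / a + b}.
Proof. by move=> a b; rewrite /mxact rmorphD mulmxDl. Qed.
HB.instance Definition _ := GRing.Zmodule_isLmodule.Build A V
  mxactA mxact1 mxactDr mxactDl.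
End MatrixModule.

(* HCl_n(0) \otimes_{H_n(0)} N, as a left HCl_n(0)-module. *)
Section Induction.
Variables (K : comNzRingType) (n : nat) (N : lmodType (H0 K n)).
Local Notation A := (HCl K n).
Local Notation tens a v := (MGen A (a, v)).

Inductive tensor_rel : mterm A (A * N) -> mterm A (A * N) -> Prop :=
  | tensor_addl a b v : tensor_rel (tens (a + b) v) (MAdd (tens a v) (tens b v))
  | tensor_addr a v w : tensor_rel (tens a (v + w)) (MAdd (tens a v) (tens a w))
  | tensor_balance a h v :
      tensor_rel (tens (a * H0_HCl K n h) v) (tens a (h *: v))
  | tensor_act b a v : tensor_rel (MScale b (tens a v)) (tens (b * a) v).

Definition Ind := pmod tensor_rel.
HB.instance Definition _ := GRing.Lmodule.on Ind.

Definition tensor (a : A) (v : N) : Ind := mgen tensor_rel (a, v).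

(* N is concentrated in degree 0. *)
Definition Ind_deg (e : bool) (x : Ind) : Prop :=
  exists2 s : seq (A * N),
    forall t, t \in s -> homog e t.1 & x = \sum_(t <- s) tensor t.1 t.2.
End Induction.

Section Grothendieck.
Variable K : fieldType.

(* A finite-dimensional supermodule, in a homogeneous basis. *)
Record smodule (n : nat) := SModule {
  sdim : nat;
  sdeg : 'I_sdim -> bool;
  srho : {rmorphism HCl K n -> 'M[K]_sdim};
  srho_const : forall a, srho (hk K n a) = a%:M;
  srho_homog : forall e x i j,
    homog e x -> srho x i j != 0 -> sdeg i = e (+) sdeg j
}.

Definition scarrier n (X : smodule n) : lmodType (HCl K n) := mxmod (srho X).

Definition vdeg n (X : smodule n) (e : bool) (v : scarrier X) : Prop :=
  forall i, (v : 'cV[K]_(sdim X)) i 0 != 0 -> sdeg i = e.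

Definition has_deg n (X Y : smodule n) (d : bool)
    (f : scarrier X -> scarrier Y) : Prop :=
  forall e v, vdeg e v -> vdeg (e (+) d) (f v).

Local Notation sgen X := (MGen K (existT smodule _ X)).

(* Supermodules are identified along homogeneous isomorphisms of either
   degree, so that M and its parity shift have the same class. *)
Inductive G0_rel :
    mterm K {n : nat & smodule n} -> mterm K {n : nat & smodule n} -> Prop :=
  | G0_iso n (X Y : smodule n) d (f : {linear scarrier X -> scarrier Y}) :
      bijective f -> has_deg d f -> G0_rel (sgen X) (sgen Y)
  | G0_exact n (X Y Z : smodule n)
      (f : {linear scarrier X -> scarrier Y})
      (g : {linear scarrier Y -> scarrier Z}) :
      has_deg false f -> has_deg false g -> injective f ->
      (forall y, g y = 0 <-> exists x, f x = y) ->
      (forall z, exists y, g y = z) ->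
      G0_rel (sgen Y) (MAdd (sgen X) (sgen Z)).

(* The direct sum over n of the Grothendieck groups of HCl_n(0), with
   coefficients extended to K: the generators and relations are the disjoint
   union over n of those of the summands. *)
Definition G0 := pmod G0_rel.
HB.instance Definition _ := GRing.Lmodule.on G0.

Definition is_model n (M : lmodType (HCl K n)) (deg : bool -> M -> Prop)
    (X : smodule n) : Prop :=
  exists2 f : {linear scarrier X -> M}, bijective f &
    forall e v, vdeg e v <-> deg e (f v).

(* The class of a supermodule M graded by deg; 0 if M is not a
   finite-dimensional supermodule. *)
Definition graded_class n (M : lmodType (HCl K n)) (deg : bool -> M -> Prop) : G0 :=
  match pselect (exists X, is_model deg X) with
  | left h => mgen G0_rel (existT smodule n (projT1 (cid h)))
  | right _ => 0
  end.

Definition Ind_class n (N : lmodType (H0 K n)) : G0 := graded_class (@Ind_deg K n N).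

Definition F_mx (n : nat) (a : seq nat) (i : 'I_n.-1) : 'M[K]_1 :=
  (if i.+1 \in Des a then -1 else 0)%:M.

Lemma F_mx_relations n a : H0_relations (@F_mx n a).
Proof.
have mC (x y : K) : x%:M * y%:M = y%:M * x%:M :> 'M_1 by exact: scalar_mx_central.
split=> [i|i j _|i j _]; rewrite /F_mx.
- by case: ifP => _; rewrite -rmorphM -rmorphN; congr _%:M;
    rewrite ?mulN1r ?mul0r ?oppr0.
- exact: mC.
- by do 2!case: ifP => _ //; rewrite ?(rmorph0, mul0r, mulr0).
Qed.

Definition F_mod n (a : seq nat) : lmodType (H0 K n) :=
  mxmod (H0_rep (@F_mx_relations n a)).

Record peak_characteristic (ch : {linear G0 -> fps K}) : Prop := {
  ch_inj : injective ch;
  ch_image : forall f, in_Peak_algebra f <-> exists x, ch x = f;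
  ch_induced : forall n a, is_comp n a ->
    ch (Ind_class (F_mod n a)) = Kfun K n (comp_of_set n (Peak (Des a)))
}.

End Grothendieck.

(* A diagram of n boxes enters only through its reading order: its boxes are
   the positions 'I_n, in reading order, and a standard filling is a permutation
   T, the box in position r having entry (T r).+1. *)
Section Fillings.
Variable n : nat.
Implicit Types (T : 'S_n) (Ts : {set 'S_n}) (i : 'I_n.-1) (r s : 'I_n).

Definition rw T : seq nat := [seq (T r : nat).+1 | r <- enum 'I_n].

Definition DesT T : seq nat :=
  [seq i <- iota 1 n.-1 | (index i.+1 (rw T) < index i (rw T))%N].

Definition swap i T : 'S_n := (T * tperm (lo i) (hi i))%g.

Definition attacking Ts i T : bool :=
  (i.+1 \notin DesT T) && (swap i T \notin Ts).

Definition ascent_at T i r s : bool :=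
  [&& (r < s)%N, T r == lo i & T s == hi i].

Definition ascent_compatible Ts : Prop :=
  forall T T' i i' r s, T \in Ts -> T' \in Ts ->
    ascent_at T i r s -> ascent_at T' i' r s ->
    attacking Ts i T = attacking Ts i' T'.

Definition dsc i T : bool := (T^-1%g (hi i) < T^-1%g (lo i))%N.

Lemma index_rw T r : index (r : nat).+1 (rw T) = T^-1%g r.
Proof.
have hq := permKV T r; set q := (T^-1)%g r in hq *.
rewrite /rw -{1}hq (index_map (f := fun q => (T q : nat).+1)); first exact: index_enum_ord.
by move=> x y [] /val_inj /perm_inj.
Qed.

Lemma DesTE i T : (i.+1 \in DesT T) = dsc i T.
Proof.
rewrite mem_filter mem_iota /= add1n ltnS ltn_ord andbT.
by rewrite -[i.+2]/((hi i : nat).+1) -[i.+1]/((lo i : nat).+1) !index_rw.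
Qed.

Section Module.
Variables (K : comNzRingType) (Ts : {set 'S_n}).

(* Matrices act on columns: entry (a, b) of N_mx i is the coefficient of the
   a-th filling in pi_(i+1) applied to the b-th filling. *)
Definition N_mx i : 'M[K]_#|Ts| :=
  \matrix_(a, b)
    let T := enum_val b in let T' := enum_val a in
    if i.+1 \in DesT T then - (T' == T)%:R
    else if attacking Ts i T then 0 else (T' == swap i T)%:R.

Let e T : 'cV[K]_#|Ts| := \col_a (enum_val a == T)%:R.

Lemma e_out T : T \notin Ts -> e T = 0.
Proof.
move=> hT; apply/colP => a; rewrite !mxE; case: eqP => // ha.
by move: hT; rewrite -ha enum_valP.
Qed.

Lemma mul_e d (B : 'M[K]_(d, #|Ts|)) b : B *m e (enum_val b) = col b B.
Proof.
apply/colP => a; rewrite !mxE (bigD1 b) //= mxE eqxx mulr1 big1 ?addr0 // => c hc.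
rewrite mxE; case: eqP => [/enum_val_inj hcb|_]; last by rewrite mulr0.
by rewrite hcb eqxx in hc.
Qed.

Lemma N_mx_e i T : T \in Ts ->
  N_mx i *m e T = if dsc i T then - e T else e (swap i T).
Proof.
move=> hT; rewrite -(enum_rankK_in hT hT); set b := enum_rank_in _ _.
rewrite mul_e; apply/colP => a; rewrite !mxE /= /attacking DesTE.
case: (dsc _ _); rewrite !mxE //=.
case: ifP => //= h; case: eqP => // ha; by rewrite -ha enum_valP in h.
Qed.

Lemma mx_ext_e (B C : 'M[K]_#|Ts|) :
  (forall T, T \in Ts -> B *m e T = C *m e T) -> B = C.
Proof.
move=> h; apply/matrixP => a b.
have := h _ (enum_valP b); rewrite !mul_e => /colP /(_ a).
by rewrite !mxE.
Qed.

Lemma swapV i T r : ((swap i T)^-1)%g r = (T^-1)%g (tperm (lo i) (hi i) r).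
Proof. by rewrite /swap invMg tpermV permM. Qed.

Lemma lo_neq_hi i : lo i != hi i.
Proof. by rewrite -val_eqE /= neq_ltn ltnSn. Qed.

Lemma posK i T : ((T^-1)%g (lo i) == (T^-1)%g (hi i)) = false.
Proof. by rewrite (inj_eq perm_inj) (negbTE (lo_neq_hi i)). Qed.

Lemma posKn i T : (((T^-1)%g (lo i) : nat) == (T^-1)%g (hi i)) = false.
Proof. by rewrite (inj_eq (@ord_inj _)) posK. Qed.

Lemma swapK i T : swap i (swap i T) = T.
Proof. by rewrite /swap -mulgA tperm2 mulg1. Qed.

Lemma dsc_swap i T : dsc i (swap i T) = ~~ dsc i T.
Proof.
rewrite /dsc !swapV tpermL tpermR -leqNgt [RHS]leq_eqVlt.
by rewrite posKn.
Qed.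

Hypothesis hTs : ascent_compatible Ts.

Lemma compat T T' i i' : T \in Ts -> T' \in Ts -> ~~ dsc i T ->
  (T^-1)%g (lo i) = (T'^-1)%g (lo i') -> (T^-1)%g (hi i) = (T'^-1)%g (hi i') ->
  (swap i T \in Ts) = (swap i' T' \in Ts).
Proof.
move=> hT hT' hd hl hh.
have lt : ((T^-1)%g (lo i) < (T^-1)%g (hi i))%N.
  by move: hd; rewrite /dsc -leqNgt leq_eqVlt posKn.
have := @hTs T T' i i' ((T^-1)%g (lo i)) ((T^-1)%g (hi i)) hT hT'.
rewrite /ascent_at lt !permKV.
have -> : T' ((T^-1)%g (lo i)) = lo i' by rewrite hl permKV.
have -> : T' ((T^-1)%g (hi i)) = hi i' by rewrite hh permKV.
rewrite !eqxx /=.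
move=> /(_ isT isT); rewrite /attacking !DesTE hd.
have -> : ~~ dsc i' T' by rewrite /dsc -hl -hh -leqNgt ltnW.
by move/negb_inj.
Qed.

Lemma N_mx_relations : H0_relations N_mx.
Proof.
split.
- move=> i; apply: mx_ext_e => T hT.
  rewrite -mulmxA mulNmx N_mx_e //; case: ifP => hd.
    by rewrite mulmxN N_mx_e // hd.
  have [hs|hs] := boolP (swap i T \in Ts).
    by rewrite N_mx_e // dsc_swap hd.
  by rewrite e_out // mulmx0 oppr0.
- move=> i j hij; apply: mx_ext_e => T hT.
  have tl : tperm (lo i) (hi i) (lo j) = lo j.
    by rewrite tpermD // -val_eqE /= neq_ltn; lia.
  have th : tperm (lo i) (hi i) (hi j) = hi j.
    by rewrite tpermD // -val_eqE /= neq_ltn; lia.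
  have tl' : tperm (lo j) (hi j) (lo i) = lo i.
    by rewrite tpermD // -val_eqE /= neq_ltn; lia.
  have th' : tperm (lo j) (hi j) (hi i) = hi i.
    by rewrite tpermD // -val_eqE /= neq_ltn; lia.
  have dji U : dsc j (swap i U) = dsc j U by rewrite /dsc !swapV tl th.
  have dij U : dsc i (swap j U) = dsc i U by rewrite /dsc !swapV tl' th'.
  have sC : swap i (swap j T) = swap j (swap i T).
    by rewrite /swap -!mulgA; congr (T * _)%g; rewrite [RHS]conjgC tpermJ tl' th'.
  rewrite -!mulmxA !N_mx_e //.
  have [di|di] := boolP (dsc i T); have [dj|dj] := boolP (dsc j T).
  + by rewrite !mulmxN !N_mx_e // di dj.
  + rewrite mulmxN (N_mx_e _ hT) (negbTE dj).
    have [hs|hs] := boolP (swap j T \in Ts).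
      by rewrite N_mx_e // dij di.
    by rewrite e_out // mulmx0 oppr0.
  + rewrite mulmxN (N_mx_e _ hT) (negbTE di).
    have [hs|hs] := boolP (swap i T \in Ts).
      by rewrite N_mx_e // dji dj.
    by rewrite e_out // mulmx0 oppr0.
  + have cj : swap i T \in Ts -> (swap j T \in Ts) = (swap j (swap i T) \in Ts).
      by move=> hs; apply: compat => //; rewrite swapV ?tl ?th.
    have ci : swap j T \in Ts -> (swap i T \in Ts) = (swap i (swap j T) \in Ts).
      by move=> hs; apply: compat => //; rewrite swapV ?tl' ?th'.
    have [hi|hi] := boolP (swap i T \in Ts); have [hj|hj] := boolP (swap j T \in Ts).
    * by rewrite !N_mx_e // dij dji (negbTE di) (negbTE dj) sC.
    * rewrite (e_out hj) mulmx0 N_mx_e // dji (negbTE dj) e_out //.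
      by rewrite -cj.
    * rewrite (e_out hi) mulmx0 N_mx_e // dij (negbTE di) e_out //.
      by rewrite -ci.
    * by rewrite !e_out // !mulmx0.
- move=> i j hij; apply: mx_ext_e => T hT.
  have lj : lo j = hi i by apply: val_inj; rewrite /= hij.
  have hne1 : hi j != lo i by rewrite -val_eqE /= hij neq_ltn; lia.
  have hne2 : hi j != hi i by rewrite -val_eqE /= hij neq_ltn; lia.
  have hne3 := lo_neq_hi i.
  have t1 : tperm (lo i) (hi i) (hi j) = hi j by rewrite tpermD // eq_sym.
  have t2 : tperm (lo j) (hi j) (lo i) = lo i by rewrite tpermD // lj // eq_sym.
  have t3 : tperm (lo i) (hi i) (lo j) = lo i by rewrite lj tpermR.
  have t4 : tperm (lo j) (hi j) (hi i) = hi j by rewrite -lj tpermL.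
  have t5 : tperm (lo i) (hi i) (hi i) = lo i by rewrite tpermR.
  have t6 : tperm (lo i) (hi i) (lo i) = hi i by rewrite tpermL.
  have t7 : tperm (lo j) (hi j) (lo j) = hi j by rewrite tpermL.
  have t8 : tperm (lo j) (hi j) (hi j) = hi i by rewrite tpermR lj.
  pose x := (T^-1)%g (lo i); pose y := (T^-1)%g (hi i); pose z := (T^-1)%g (hi j).
  have tE := (t1, t2, t3, t4, t5, t6, t7, t8).
  have sw : swap i (swap j (swap i T)) = swap j (swap i (swap j T)).
    apply: invg_inj; apply/permP => r; rewrite !swapV; congr ((_ : 'S_n) _).
    have [->|ri] := eqVneq r (lo i); first by rewrite !tE.
    have [->|rj] := eqVneq r (hi i); first by rewrite !tE.
    have [->|rk] := eqVneq r (hi j); first by rewrite !tE.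
    have si : tperm (lo i) (hi i) r = r by rewrite tpermD // eq_sym.
    have sj : tperm (lo j) (hi j) r = r by rewrite tpermD // ?lj // eq_sym.
    by rewrite !(si, sj).
  have Di : dsc i T = (y < x)%N by [].
  have Dj : dsc j T = (z < y)%N by rewrite /dsc lj.
  have Dji : dsc j (swap i T) = (z < x)%N by rewrite /dsc !swapV !tE.
  have Dij : dsc i (swap j T) = (z < x)%N by rewrite /dsc !swapV !tE.
  have Diji : dsc i (swap j (swap i T)) = (z < y)%N by rewrite /dsc !swapV !tE.
  have Djij : dsc j (swap i (swap j T)) = (y < x)%N by rewrite /dsc !swapV !tE.
  have c1 : ~~ (y < x)%N -> swap i (swap j T) \in Ts ->
      (swap i T \in Ts) = (swap j (swap i (swap j T)) \in Ts).
    by move=> h hs; apply: compat => //; rewrite !swapV !tE.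
  have c2 : ~~ (z < y)%N -> swap j (swap i T) \in Ts ->
      (swap j T \in Ts) = (swap j (swap i (swap j T)) \in Ts).
    move=> h hs; rewrite -sw; apply: compat => //; rewrite ?Dj //.
      by rewrite !swapV !tE lj.
    by rewrite !swapV !tE.
  have c3 : ~~ (z < x)%N -> swap i T \in Ts -> swap j T \in Ts ->
      (swap j (swap i T) \in Ts) = (swap i (swap j T) \in Ts).
    by move=> h hs hs'; apply: compat => //; rewrite ?Dji // !swapV !tE.
  have NE k U : N_mx k *m e U =
      if U \in Ts then (if dsc k U then - e U else e (swap k U)) else 0.
    by case: ifPn => hU; [rewrite N_mx_e | rewrite e_out // mulmx0].
  have DE := (Di, Dj, Dji, Dij, Diji, Djij, dsc_swap).
  rewrite -!mulmxA.
  have [d1|d1] := boolP (y < x)%N; have [d2|d2] := boolP (z < y)%N.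
  + by rewrite !(mulmxN, NE, hT, DE, d1, d2).
  + rewrite !(NE _ T) hT !DE d1 (negbTE d2) !mulmxN (NE j T) hT !DE (negbTE d2).
    have [m|m] := boolP (swap j T \in Ts); last by rewrite e_out // !(mulmx0, oppr0).
    rewrite (NE i (swap j T)) m !DE; case: ifP => d3.
      by rewrite !mulmxN NE m !DE (negbTE d2).
    by rewrite NE; case: ifPn => m'; [rewrite !DE d1 | rewrite e_out ?oppr0].
  + rewrite !(NE _ T) hT !DE d2 (negbTE d1) !mulmxN (NE i T) hT !DE (negbTE d1).
    have [m|m] := boolP (swap i T \in Ts); last by rewrite e_out // !(mulmx0, oppr0).
    rewrite (NE j (swap i T)) m !DE; case: ifP => d3.
      by rewrite !mulmxN NE m !DE (negbTE d1).
    by rewrite NE; case: ifPn => m'; [rewrite !DE d2 | rewrite e_out ?oppr0].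
  + have d3 : (z < x)%N = false by apply/negbTE; rewrite -!leqNgt in d1 d2 *; apply: leq_trans d1 d2.
    have LE : N_mx i *m (N_mx j *m (N_mx i *m e T)) =
        if (swap i T \in Ts) && (swap j (swap i T) \in Ts)
        then e (swap i (swap j (swap i T))) else 0.
      rewrite (NE _ T) hT !DE (negbTE d1) NE !DE d3.
      case: (swap i T \in Ts); last by rewrite mulmx0.
      by rewrite NE !DE (negbTE d2).
    have RE : N_mx j *m (N_mx i *m (N_mx j *m e T)) =
        if (swap j T \in Ts) && (swap i (swap j T) \in Ts)
        then e (swap j (swap i (swap j T))) else 0.
      rewrite (NE _ T) hT !DE (negbTE d2) NE !DE d3.
      case: (swap j T \in Ts); last by rewrite mulmx0.
      by rewrite NE !DE (negbTE d1).
    rewrite LE RE sw.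
    have [w|w] := boolP (swap j (swap i (swap j T)) \in Ts); last first.
      by rewrite e_out // !if_same.
    suff -> : (swap i T \in Ts) && (swap j (swap i T) \in Ts) =
              (swap j T \in Ts) && (swap i (swap j T) \in Ts) by [].
    have := c1 d1; have := c2 d2; have := c3 (negbT d3); rewrite w.
    case: (swap i T \in Ts) => /= c3' c2' c1'.
      case: (swap j T \in Ts) c3' c2' => /= c3' c2'; first exact: c3'.
      by apply/negbTE/negP => /c2'.
    by apply/esym/negbTE/negP => /andP[_ /c1'].
Qed.
End Module.
End Fillings.

(* Boxes are pairs (row, column), both counted from 0, rows from bottom to
   top. *)
Definition in_diagram (a : seq nat) (x : nat * nat) : bool :=
  (x.2 < nth 0%N a x.1)%N.

(* The boxes of D(alpha), in reading order. *)
Definition reading (a : seq nat) : seq (nat * nat) :=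
  [seq (r, c) | c <- iota 0 (sumn a),
                r <- [seq r <- iota 0 (size a) | in_diagram a (r, c)]].

Definition entry n (a : seq nat) (T : 'S_n) (x : nat * nat) : nat :=
  nth 0%N (rw T) (index x (reading a)).

Record is_SPCT n (a : seq nat) (T : 'S_n) : Prop := {
  SPCT1 : forall r c c', (c < c')%N -> in_diagram a (r, c') ->
    (entry a T (r, c) < entry a T (r, c'))%N;
  SPCT2 : forall r r', (r < r')%N -> in_diagram a (r', 0%N) ->
    (entry a T (r, 0%N) < entry a T (r', 0%N))%N;
  SPCT3 : forall k, (1 <= k <= n)%N ->
    exists2 b, is_peak_comp (sumn b) b &
      forall x, in_diagram a x && (entry a T x <= k)%N = in_diagram b x
}.

Definition SPCT (n : nat) (a : seq nat) : {set 'S_n} :=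
  [set T | `[< is_SPCT a T >]].

Lemma in_diagram_size a x : in_diagram a x -> (x.1 < size a)%N.
Proof.
by rewrite /in_diagram; case: (ltnP x.1 (size a)) => // h; rewrite nth_default.
Qed.

Lemma nth_le_sumn a r : (nth 0 a r <= sumn a)%N.
Proof.
elim: a r => [|p a IH] [|r] //=; first exact: leq_addr.
exact: leq_trans (IH r) (leq_addl _ _).
Qed.

Lemma mem_reading a x : (x \in reading a) = in_diagram a x.
Proof.
apply/allpairsPdep/idP => [[c [r [_ + ->]]]|].
  by rewrite mem_filter => /andP[].
case: x => r c h; exists c, r; split=> //.
  by rewrite mem_iota add0n; apply: leq_trans h (nth_le_sumn _ _).
by rewrite mem_filter h mem_iota add0n; apply: in_diagram_size h.
Qed.

Lemma reading_uniq a : uniq (reading a).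
Proof.
apply: allpairs_uniq_dep; first exact: iota_uniq.
  by move=> c _; rewrite filter_uniq // iota_uniq.
by move=> [c r] [c' r'] _ _ /= [-> ->].
Qed.

Lemma size_reading a : size (reading a) = sumn a.
Proof.
rewrite size_allpairs_dep sumnE big_map.
under eq_bigr => c _ do rewrite size_filter -sum1_count.
rewrite (exchange_big_dep xpredT) //=.
rewrite sumnE [RHS](big_nth 0%N) /index_iota subn0; apply: eq_bigr => r _.
rewrite sum1_count -size_filter -sumnE.
have -> : [seq c <- iota 0 (sumn a) | in_diagram a (r, c)] = iota 0 (nth 0 a r).
  apply: (irr_sorted_eq ltn_trans ltnn).
  - exact/sorted_filter/iota_ltn_sorted/ltn_trans.
  - exact: iota_ltn_sorted.
  move=> c; rewrite mem_filter !mem_iota !add0n /= /in_diagram /=.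
  by case: ltnP => //= h; apply: leq_trans h (nth_le_sumn _ _).
by rewrite size_iota.
Qed.

Lemma reading_cols a : pairwise (fun x y => x.2 <= y.2)%N (reading a).
Proof.
rewrite /reading; have := iota_sorted 0 (sumn a).
elim: (iota _ _) => [|c s IH] //= hs.
rewrite pairwise_cat IH ?(path_sorted hs) // andbT; apply/andP; split.
  apply/allrelP => x y /mapP[r _ ->] /allpairsPdep[c' [r' [hc' _ ->]]] /=.
  have := order_path_min leq_trans hs; move/allP; exact.
by elim: [seq r <- _ | _] => //= r t ->; rewrite andbT all_map; apply/allP => r' _ /=.
Qed.

Lemma peak_compP b : is_peak_comp (sumn b) b <->
  (forall j, j < size b -> 1 <= nth 0 b j)%N /\
  (forall j, j.+1 < size b -> 2 <= nth 0 b j)%N.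
Proof.
rewrite /is_peak_comp /is_comp eqxx andbT; split.
  move=> /andP[/(all_nthP 0%N) h1 /(all_nthP 0%N) h2]; split=> j hj; first exact: h1.
  have hj' : (j < (size b).-1)%N by rewrite ltn_predRL.
  have := h2 j; rewrite nth_take //; apply.
  by rewrite size_take; case: ifP => // _; exact: ltnW.
move=> [h1 h2]; apply/andP; split; apply/(all_nthP 0%N) => j hj; first exact: h1.
move: hj; rewrite size_take => hj.
have hj' : (j < (size b).-1)%N.
  move: hj; case: ifP => // /negbT; rewrite -leqNgt => h hj.
  exact: leq_trans hj h.
by rewrite nth_take //; apply: h2; rewrite -ltn_predRL.
Qed.

Section SPCTCompatible.
Variables (n : nat) (a : seq nat).
Hypothesis ha : is_peak_comp n a.

Let bx (r : 'I_n) := nth (0, 0)%N (reading a) r.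

Let size_a : size (reading a) = n.
Proof. by rewrite size_reading; move: ha => /andP[/andP[_ /eqP]]. Qed.

Let bx_in r : in_diagram a (bx r).
Proof. by rewrite -mem_reading mem_nth // size_a. Qed.

Let bx_inj : injective bx.
Proof.
move=> r s /eqP; rewrite nth_uniq ?size_a ?reading_uniq // => /eqP.
exact: ord_inj.
Qed.

Let bxP x : in_diagram a x -> exists r, x = bx r.
Proof.
rewrite -mem_reading => hx.
have lt : (index x (reading a) < n)%N by rewrite -size_a index_mem.
by exists (Ordinal lt); rewrite /bx nth_index.
Qed.

Let entry_bx T r : entry a T (bx r) = (T r : nat).+1.
Proof.
rewrite /entry index_uniq ?size_a ?reading_uniq // /rw.
by rewrite (nth_map r) ?size_enum_ord // nth_ord_enum.
Qed.

Let bx_col (r s : 'I_n) : (r < s)%N -> ((bx r).2 <= (bx s).2)%N.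
Proof.
move=> rs; have /(pairwiseP (0, 0)%N) := reading_cols a; apply=> //;
by rewrite inE size_a.
Qed.

Let row0 r : (r < size a)%N -> in_diagram a (r, 0%N).
Proof.
move: ha => /andP[/andP[/(all_nthP 0%N) h _] _] hr; exact: h.
Qed.

Let left r c c' : (c < c')%N -> in_diagram a (r, c') -> in_diagram a (r, c).
Proof. exact: ltn_trans. Qed.

Let bad r s := ((bx r).1 == (bx s).1) || ((bx r).2 == 0%N) && ((bx s).2 == 0%N).

Let swap_SPCT T i r s : is_SPCT a T -> ascent_at T i r s ->
  is_SPCT a (swap i T) <-> ~~ bad r s.
Proof.
move=> hT /and3P[rs /eqP Tr /eqP Ts].
have rsn : r != s by rewrite -val_eqE /= neq_ltn rs.
have lh : lo i != hi i by rewrite -val_eqE /= neq_ltn ltnSn.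
have er : entry a T (bx r) = i.+1 by rewrite entry_bx Tr.
have es : entry a T (bx s) = i.+2 by rewrite entry_bx Ts.
have er' : entry a (swap i T) (bx r) = i.+2.
  by rewrite entry_bx /swap permM Tr tpermL.
have es' : entry a (swap i T) (bx s) = i.+1.
  by rewrite entry_bx /swap permM Ts tpermR.
have eo q : q != r -> q != s ->
    [/\ entry a (swap i T) (bx q) = entry a T (bx q),
        entry a T (bx q) != i.+1 & entry a T (bx q) != i.+2].
  move=> qr qs; rewrite !entry_bx /swap permM.
  have nl : T q != lo i by rewrite -Tr (inj_eq perm_inj).
  have nh : T q != hi i by rewrite -Ts (inj_eq perm_inj).
  have -> : tperm (lo i) (hi i) (T q) = T q by rewrite tpermD // eq_sym.
  rewrite !eqSS; move: nl nh; rewrite -!val_eqE => nl nh.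
  by split.
split.
  case=> h1 h2 _; apply/negP => /orP[/eqP hr|/andP[/eqP c1 /eqP c2]].
  - have br := bx_in r; have bs := bx_in s.
    move: er er' es es' br bs (@bx_inj r s); rewrite (surjective_pairing (bx r)) (surjective_pairing (bx s)) hr.
    case: (ltngtP (bx r).2 (bx s).2) => [lt|gt|eq] er er' es es' br bs inj.
    + by have := h1 _ _ _ lt bs; rewrite er' es' ltnNge leqnSn.
    + by have := SPCT1 hT gt br; rewrite er es ltnNge leqnSn.
    + by rewrite eq in inj; move: rsn; rewrite inj ?eqxx.
  - have br := bx_in r; have bs := bx_in s.
    move: er er' es es' br bs (@bx_inj r s); rewrite (surjective_pairing (bx r)) (surjective_pairing (bx s)) c1 c2.
    case: (ltngtP (bx r).1 (bx s).1) => [lt|gt|eq] er er' es es' br bs inj.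
    + by have := h2 _ _ lt bs; rewrite er' es' ltnNge leqnSn.
    + by have := SPCT2 hT gt br; rewrite er es ltnNge leqnSn.
    + by rewrite eq in inj; move: rsn; rewrite inj ?eqxx.
rewrite negb_or negb_and => /andP[hrow hcol].
have mono x y : in_diagram a x -> in_diagram a y ->
    ~~ ((x == bx r) && (y == bx s)) ->
    (entry a T x < entry a T y)%N ->
    (entry a (swap i T) x < entry a (swap i T) y)%N.
  move=> /bxP[p ->] /bxP[q ->]; rewrite !(inj_eq bx_inj).
  have [->|pr] := eqVneq p r; have [->|qr] := eqVneq q r.
  - by rewrite ltnn.
  - have [->|qs] := eqVneq q s => //= _; rewrite er er'.
    by have [-> _ ne] := eo _ qr qs; rewrite [(i.+2 < _)%N]ltn_neqAle eq_sym ne.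
  - rewrite er er' => _; have [->|ps] := eqVneq p s; first by rewrite es es'.
    have [-> _ _] := eo _ pr ps; exact: ltnW.
  have [->|ps] := eqVneq p s; have [->|qs] := eqVneq q s => /= _.
  - by rewrite ltnn.
  - by rewrite es es'; have [-> _ _] := eo _ qr qs; apply: ltn_trans.
  - rewrite es es'; have [-> ne _] := eo _ pr ps.
    by rewrite ltnS => h; rewrite ltn_neqAle ne.
  - by have [-> _ _] := eo _ pr ps; have [-> _ _] := eo _ qr qs.
split.
- move=> p c c' cc hx; have hx' := left cc hx.
  apply: mono => //; last exact: (SPCT1 hT).
  apply/negP => /andP[/eqP e1 /eqP e2].
  by move: hrow; rewrite -e1 -e2 eqxx.
- move=> p p' pp hx.
  have hx' : in_diagram a (p, 0%N).
    apply: row0; exact: ltn_trans pp (in_diagram_size hx).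
  apply: mono => //; last exact: (SPCT2 hT).
  apply/negP => /andP[/eqP e1 /eqP e2].
  by move: hcol; rewrite -e1 -e2 eqxx.
move=> k hk; have [{hk}->|ki] := eqVneq k i.+1; last first.
  have [b hb hb'] := SPCT3 hT hk; exists b => // x; rewrite -hb'.
  have [/bxP[q ->]|] //= := boolP (in_diagram a x).
  have [->|qr] := eqVneq q r; first by rewrite er er'; lia.
  have [->|qs] := eqVneq q s; first by rewrite es es'; lia.
  by have [-> _ _] := eo _ qr qs.
have hin : (i.+1 < n)%N := hi_subproof i.
have [b hb hb'] : exists2 b, is_peak_comp (sumn b) b &
    forall x, in_diagram a x && (entry a T x <= i)%N = in_diagram b x.
  have [i0|ip] := posnP (i : nat); last by apply: (SPCT3 hT); rewrite ip /= ltnW // ltnW.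
  exists [::] => // x; rewrite i0 {2}/in_diagram nth_nil ltn0.
  by have [/bxP[q ->]|] //= := boolP (in_diagram a x); rewrite entry_bx.
have [b2 _ hb2'] := SPCT3 hT (k := i.+2) hin.
set x := bx s; have xin : in_diagram a x := bx_in s.
have x2 : (0 < x.2)%N.
  rewrite lt0n; apply/negP => /eqP x20; have := bx_col rs; rewrite -/x x20 leqn0 => /eqP r0.
  by move: hcol; rewrite r0 -/x x20.
have px : in_diagram b (x.1, x.2.-1).
  have h2 : in_diagram b2 (x.1, x.2.-1).
    have : in_diagram b2 x by rewrite -hb2' xin es leqnn.
    by rewrite /in_diagram /=; apply: leq_trans; rewrite ltnS leq_pred.
  move: h2; rewrite -hb2' => /andP[h2 h3]; rewrite -hb' h2 /=.
  have [q eq] := bxP h2; rewrite eq in h3 *.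
  have qs : q != s.
    apply/eqP => eqs; move: eq; rewrite eqs -/x => /(congr1 snd) /= ex.
    by move: x2; rewrite -ex; case: (x.2) ex => //= m em _; move: (ltnSn m); rewrite -{2}em ltnn.
  have qr : q != r.
    by apply/eqP => eqs; move: hrow; rewrite -eqs -eq /= eqxx.
  have [_ n1 n2] := eo _ qr qs; lia.
have nx : in_diagram b x = false by rewrite -hb' es; apply/negbTE; rewrite negb_and; lia.
have bx1 : nth 0%N b x.1 = x.2.
  move: px nx; rewrite /in_diagram /=; lia.
have xs : (x.1 < size b)%N := in_diagram_size px.
exists (incr_nth b x.1).
  move: hb => /peak_compP[h1 h2]; apply/peak_compP; rewrite size_incr_nth xs.
  split=> j hj; rewrite nth_incr_nth; first by apply: leq_trans (h1 _ hj) (leq_addl _ _).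
  by apply: leq_trans (h2 _ hj) (leq_addl _ _).
move=> y; have -> : in_diagram (incr_nth b x.1) y = in_diagram b y || (y == x).
  rewrite /in_diagram nth_incr_nth -pair_eqE /= /pair_eq /=.
  have [<-|ne] := eqVneq x.1 y.1; rewrite ?eqxx /=.
    by rewrite bx1 add1n ltnS leq_eqVlt orbC.
  by rewrite add0n /= ?orbF.
rewrite -hb'; have [/bxP[q ->]|yn] /= := boolP (in_diagram a y); last first.
  by apply/esym/eqP => yx; rewrite yx xin in yn.
rewrite (inj_eq bx_inj).
have [->|qr] := eqVneq q r; first by rewrite er er' (negbTE rsn); lia.
have [->|qs] := eqVneq q s; first by rewrite es es'; lia.
by have [-> n1 n2] := eo _ qr qs; lia.
Qed.

Lemma SPCT_ascent_compatible : ascent_compatible (SPCT n a).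
Proof.
move=> T T' i i' r s; rewrite !inE => /asboolP hT /asboolP hT' h h'.
have key U j : is_SPCT a U -> ascent_at U j r s ->
    attacking (SPCT n a) j U = bad r s.
  move=> hU hj; rewrite /attacking DesTE inE.
  have -> : dsc j U = false.
    rewrite /dsc; case/and3P: hj => rs /eqP <- /eqP <-; rewrite !permK.
    by apply/negbTE; rewrite -leqNgt ltnW.
  rewrite /= -[RHS]negbK; congr negb.
  apply/asboolP/idP; first by move/(swap_SPCT hU hj).
  by move=> hb; apply/(swap_SPCT hU hj).
by rewrite (key _ _ hT h) (key _ _ hT' h').
Qed.
End SPCTCompatible.

Definition N_mod (K : fieldType) n (Ts : {set 'S_n})
    (hTs : ascent_compatible Ts) : lmodType (H0 K n) :=
  mxmod (H0_rep (N_mx_relations K hTs)).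

(* The quasisymmetric Schur Q-function. *)
Definition Qtilde (K : fieldType) (n : nat) (a : seq nat) : fps K :=
  \sum_(T in SPCT n a) Kfun K n (comp_of_set n (Peak (DesT T))).

(* Main.v *)
(* Induction from H_n(0) to HCl_n(0) is exact because HCl_n(0) is free as a right
   H_n(0)-module on the ordered monomials in the c_j. Freeness is shown by letting
   HCl_n(0) act on Cl_n (x) N: if s_i is the automorphism of the Clifford algebra
   Cl_n exchanging c_i and c_(i+1), then t_i = pi_i + (1 + c_i c_(i+1)) / 2
   satisfies t_i x = s_i(x) t_i for x in Cl_n; moreover s_i is the twisted
   conjugation by c_i - c_(i+1), hence is expressible through left and right
   multiplications. This gives a closed formula for the action of pi_i.

   The module of the standard peak composition tableaux is triangular with respect
   to the statistic T |-> \sum_r r * T r, which strictly decreases when a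
   nonattacking ascent is exchanged; its composition factors are the F_alpha with
   alpha the descent composition of T. Exactness carries the filtration to the
   induced module. *)

From HB Require Import structures.
Require Import Defs.
From mathcomp Require Import all_boot all_order all_algebra all_fingroup.
From mathcomp Require Import boolp reals complex mxtens zify.

Set Implicit Arguments.
Unset Strict Implicit.
Unset Printing Implicit Defensive.

Import GRing.Theory.
Local Open Scope ring_scope.

(** * Compositions and weights of fillings *)

Section CompositionOfSet.
Local Open Scope nat_scope.
Implicit Types (x n : nat) (s X : seq nat).

Lemma sumn_pairmap_subn x s : path leq x s ->
  sumn (pairmap (fun x y => y - x) x s) = last x s - x.
Proof.
elim: s x => [|y s IH] x /=; first by rewrite subnn.
move=> /andP[xy ys]; rewrite IH //.
have : y <= last y s.
  have /allP h := order_path_min leq_trans ys.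
  by have := mem_last y s; rewrite inE => /orP[/eqP -> // | /h].
lia.
Qed.

Lemma take_pairmap (T1 T2 : Type) (f : T1 -> T1 -> T2) (x : T1) (s : seq T1) i :
  take i (pairmap f x s) = pairmap f x (take i s).
Proof. by elim: s x i => [|y s IH] x [|i] //=; rewrite IH. Qed.

Lemma pairmap_subn_gt0 x s : path ltn x s ->
  all (leq 1) (pairmap (fun x y => y - x) x s).
Proof.
by elim: s x => //= y s IH x /andP[xy ys]; rewrite IH // andbT subn_gt0.
Qed.

Lemma comp_of_set_rcons n X : [seq i <- iota 1 n.+1 | (i \in X) || (i == n.+1)] =
  rcons [seq i <- iota 1 n | i \in X] n.+1.
Proof.
have -> : iota 1 n.+1 = rcons (iota 1 n) n.+1.
  by rewrite -cats1 -[n.+1 in LHS]addn1 iotaD add1n.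
rewrite filter_rcons eqxx orbT; congr rcons; apply: eq_in_filter => i.
by rewrite mem_iota; case: eqP; rewrite ?orbF //; lia.
Qed.

Lemma comp_of_setE n X : comp_of_set n.+1 X =
  pairmap (fun x y => y - x) 0 (rcons [seq i <- iota 1 n | i \in X] n.+1).
Proof. by rewrite /comp_of_set comp_of_set_rcons. Qed.

Lemma path_ltn_rcons_iota n X :
  path ltn 0 (rcons [seq i <- iota 1 n | i \in X] n.+1).
Proof.
rewrite -comp_of_set_rcons (path_sortedE ltn_trans); apply/andP; split.
  by apply/allP => i; rewrite mem_filter mem_iota; lia.
exact/(sorted_filter ltn_trans)/iota_ltn_sorted.
Qed.

Lemma comp_of_set_comp n X : is_comp n (comp_of_set n X).
Proof.
case: n => [|n] //; rewrite comp_of_setE /is_comp.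
have h := path_ltn_rcons_iota n X; rewrite pairmap_subn_gt0 //=.
rewrite sumn_pairmap_subn ?last_rcons ?subn0 //.
by apply: sub_path h => x y; exact: ltnW.
Qed.

(** Partial sums of successive differences telescope back to the listed elements; the final one,
    [n], is dropped because [Des] omits the total sum. *)
Lemma Des_comp_of_set n X :
  Des (comp_of_set n X) = [seq i <- iota 1 n.-1 | i \in X].
Proof.
case: n => [|n] //; rewrite comp_of_setE /Des size_pairmap size_rcons /=.
have h := path_ltn_rcons_iota n X; set t := [seq i <- _ | _] in h *.
apply: (@eq_from_nth _ 0); rewrite size_map size_iota // => i hi.
rewrite (nth_map 0) ?size_iota // nth_iota // add1n take_pairmap.
rewrite sumn_pairmap_subn; last first.
  by apply: take_path; apply: sub_path h => x y; exact: ltnW.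
rewrite subn0 -nth_last size_take size_rcons ltnS hi /= nth_take //.
by rewrite nth_rcons hi.
Qed.
End CompositionOfSet.

(** Identifies [comp_of_set n (DesT T)] as the descent composition of [T], the label of the
    composition factor attached to [T]. *)
Lemma Des_comp_of_DesT n (T : 'S_n) : Des (comp_of_set n (DesT T)) = DesT T.
Proof.
rewrite Des_comp_of_set; apply: eq_in_filter => i hi.
by rewrite mem_filter hi andbT.
Qed.

(** The values [lo i] and [hi i] sit at positions [r < s] and differ by one, so exchanging them
    lowers the weight by exactly [s - r]. *)
Lemma swap_weight n (T : 'S_n) i : ~~ dsc i T ->
  (\sum_(r < n) r * swap i T r < \sum_(r < n) r * T r)%N.
Proof.
move=> hd; set r := (T^-1)%g (lo i); set s := (T^-1)%g (hi i).
have rs : (r < s)%N by move: hd; rewrite /dsc -leqNgt leq_eqVlt posKn.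
have srn : s != r by rewrite -val_eqE /= gtn_eqF.
rewrite (bigD1 r) //= (bigD1 s) //= [X in (_ < X)%N](bigD1 r) //=.
rewrite [X in (_ < _ + X)%N](bigD1 s) //= /swap !permM !permKV tpermL tpermR /=.
rewrite (eq_bigr (fun q : 'I_n => q * T q)%N); first by lia.
move=> q /andP[qr qs]; rewrite permM tpermD //.
  by rewrite eq_sym; apply: contraNneq qr => h; rewrite /r -h permK.
by rewrite eq_sym; apply: contraNneq qs => h; rewrite /s -h permK.
Qed.

(** * Relations of the Hecke-Clifford algebra *)

Section CrossRelations.
Variable A : pzRingType.
Implicit Types (c r p q s : A).

(** The inhomogeneous relation as a rewriting rule: [p] moves past [c'] at the cost of the lower
    terms [c - c']. *)
Lemma cross_hi p c c' : (p + 1) * c' = c * (p + 1) ->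
  p * c' = c * p + c - c'.
Proof.
by rewrite mulrDl mulrDr mul1r mulr1 => /(canRL (addrK c')).
Qed.

Lemma anti_sandwich c c' : c * c = -1 -> c' * c = - (c * c') ->
  c * c' * c = c'.
Proof. by move=> cc c'c; rewrite -mulrA c'c mulrN mulrA cc mulN1r opprK. Qed.

Section HeckeClifford.
Variables (h c c' r r' p : A).
Hypotheses (h2 : h + h = 1) (hC : forall x, h * x = x * h).
Hypotheses (cc : c * c = -1) (cc' : c' * c' = -1) (c'c : c' * c = - (c * c')).
Hypotheses (rc : r * c = - (c * r)) (rc' : r * c' = - (c' * r)).
Hypotheses (r'c : r' * c = - (c * r')) (r'c' : r' * c' = - (c' * r')).
Hypotheses (pc : p * c = c * p) (pc' : p * c' = c' * p).

(* With [r], [r'] the operators [x |-> (-1)^|x| x c], [x |-> (-1)^|x| x c'] and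
   [h = 1/2], [cswap] is the exchange [s] of [c] and [c'], and [hecke_pi] maps
   [x (x) v] to [s x (x) p v + (a x - s x a) (x) v] where [a = - (1 + c c') / 2]. *)
Definition cswap := - (h * ((c - c') * (r - r'))).
Definition hecke_pi := cswap * (p + h * (1 - r * r')) - h * (1 + c * c').

(** An odd [x] passes the even product [r * r'] with two cancelling signs; [cswap_even] uses the
    same cancellation. *)
Lemma even_comm x : r * x = - (x * r) -> r' * x = - (x * r') ->
  p * x = x * p -> (p + h * (1 - r * r')) * x = x * (p + h * (1 - r * r')).
Proof.
move=> rx r'x px; rewrite mulrDl [RHS]mulrDr px; congr (_ + _).
rewrite -[LHS]mulrA [RHS]mulrA -hC -[RHS]mulrA; congr (_ * _).
rewrite mulrBl mulrBr mul1r mulr1; congr (_ - _).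
by rewrite -mulrA r'x mulrN mulrA rx mulNr opprK mulrA.
Qed.

Lemma cswap_even x : c * x = - (x * c) -> c' * x = - (x * c') ->
  r * x = - (x * r) -> r' * x = - (x * r') -> cswap * x = x * cswap.
Proof.
move=> cx c'x rx r'x; rewrite /cswap mulNr mulrN; congr (- _).
rewrite -[LHS]mulrA [RHS]mulrA -hC -[RHS]mulrA; congr (_ * _).
rewrite -mulrA [X in _ * X]mulrBl rx r'x -opprD -mulrBr mulrN mulrA.
rewrite [X in - (X * _)]mulrBl cx c'x.
by rewrite -opprD -mulrBr mulNr opprK mulrA.
Qed.

Lemma hecke_pi_comm x : c * x = - (x * c) -> c' * x = - (x * c') ->
  r * x = - (x * r) -> r' * x = - (x * r') -> p * x = x * p ->
  hecke_pi * x = x * hecke_pi.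
Proof.
move=> cx c'x rx r'x px; rewrite /hecke_pi mulrBl [RHS]mulrBr; congr (_ - _).
  by rewrite -[LHS]mulrA even_comm // [LHS]mulrA (cswap_even cx) // -mulrA.
rewrite -[LHS]mulrA [RHS]mulrA -hC -[RHS]mulrA; congr (_ * _).
rewrite mulrDl mulrDr mul1r mulr1; congr (_ + _).
by rewrite -mulrA c'x mulrN mulrA cx mulNr opprK mulrA.
Qed.

(** Passing [r - r'] costs a sign, and [-(c - c') c = 1 - c c' = c' (c - c')]: this is the twisted
    conjugation by [c - c']. *)
Lemma cswap_lo : cswap * c = c' * cswap.
Proof.
rewrite /cswap mulNr mulrN; congr (- _).
rewrite -[LHS]mulrA [RHS]mulrA -hC -[RHS]mulrA; congr (_ * _).
rewrite -mulrA [X in _ * X]mulrBl rc r'c -opprD -mulrBr mulrN -mulNr !mulrA.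
congr (_ * _).
by rewrite opprB mulrBl mulrBr cc cc' c'c.
Qed.

Lemma cswap_hi : cswap * c' = c * cswap.
Proof.
rewrite /cswap mulNr mulrN; congr (- _).
rewrite -[LHS]mulrA [RHS]mulrA -hC -[RHS]mulrA; congr (_ * _).
rewrite -mulrA [X in _ * X]mulrBl rc' r'c' -opprD -mulrBr mulrN -mulNr !mulrA.
congr (_ * _).
by rewrite opprB mulrBl mulrBr cc cc'.
Qed.

Lemma hecke_pi_lo : hecke_pi * c = c' * hecke_pi.
Proof.
rewrite /hecke_pi mulrBl [RHS]mulrBr; congr (_ - _).
  by rewrite -[LHS]mulrA even_comm // [LHS]mulrA cswap_lo -mulrA.
rewrite -[LHS]mulrA [RHS]mulrA -hC -[RHS]mulrA; congr (_ * _).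
rewrite mulrDl mulrDr mul1r mulr1 anti_sandwich // mulrA c'c mulNr -mulrA cc'.
by rewrite mulrN1 opprK addrC.
Qed.

Lemma hecke_pi_hi : (hecke_pi + 1) * c' = c * (hecke_pi + 1).
Proof.
(* As [1 = h + h], adding 1 turns [- h (1 + c c')] into [h (1 - c c')], and both [(1 - c c') c'] and
   [c (1 - c c')] equal [c + c']. *)
have E : hecke_pi + 1 = cswap * (p + h * (1 - r * r')) + h * (1 - c * c').
  rewrite /hecke_pi -addrA; congr (_ + _).
  by rewrite !mulrDr !mulr1 mulrN opprD -h2 addrC addrA addrK.
rewrite {}E mulrDl [RHS]mulrDr; congr (_ + _).
  by rewrite -[LHS]mulrA even_comm // [LHS]mulrA cswap_hi -mulrA.
rewrite -[LHS]mulrA [RHS]mulrA -hC -[RHS]mulrA; congr (_ * _).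
rewrite mulrBl mulrBr mul1r mulr1 -mulrA cc' mulrA cc mulrN1 mulN1r !opprK.
by rewrite addrC.
Qed.
End HeckeClifford.

(** The inhomogeneous terms coming from [p * p] cancel against those of [p]. This and the following
    lemmas move the defect of each Hecke relation past the Clifford generators, as [ind_ext]
    requires. *)
Lemma quad_lo p c c' : p * c = c' * p -> (p + 1) * c' = c * (p + 1) ->
  (p * p + p) * c = c * (p * p + p).
Proof.
move=> lo /cross_hi hi; rewrite mulrDl mulrDr -mulrA lo mulrA hi.
by rewrite mulrBl mulrDl subrK !mulrA.
Qed.

Lemma quad_hi p c c' : p * c = c' * p -> (p + 1) * c' = c * (p + 1) ->
  (p * p + p) * c' = c' * (p * p + p).
Proof.
move=> lo /cross_hi hi; rewrite mulrDl [RHS]mulrDr -mulrA [X in p * X]hi.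
by rewrite mulrBr mulrDr subrK mulrA lo -mulrA.
Qed.

Lemma quad_comm p x : p * x = x * p -> (p * p + p) * x = x * (p * p + p).
Proof. by move=> px; rewrite mulrDl mulrDr -mulrA px mulrA px mulrA. Qed.

Lemma commutator_lo p q c c' : p * c = c' * p -> q * c = c * q ->
  q * c' = c' * q -> (p * q - q * p) * c = c' * (p * q - q * p).
Proof.
move=> pc qc qc'; rewrite mulrBl [RHS]mulrBr -[p * q * c]mulrA qc.
by rewrite -[q * p * c]mulrA pc [p * _]mulrA pc [q * _]mulrA qc' -!mulrA.
Qed.

Lemma commutator_hi p q c c' : (p + 1) * c' = c * (p + 1) -> q * c = c * q ->
  q * c' = c' * q -> (p * q - q * p) * c' = c * (p * q - q * p).
Proof.
move=> /cross_hi pc' qc qc'; rewrite mulrBl [RHS]mulrBr -[p * q * c']mulrA qc'.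
rewrite -[q * p * c']mulrA pc' [p * _]mulrA pc' !(mulrBr, mulrDr, mulrBl, mulrDl).
rewrite !mulrA qc qc' -[c * p * q + _ - _]addrA -[c * q * p + _ - _]addrA.
by rewrite opprD addrACA subrr addr0.
Qed.

Lemma commutator_comm p q x : p * x = x * p -> q * x = x * q ->
  (p * q - q * p) * x = x * (p * q - q * p).
Proof.
move=> px qx; rewrite mulrBl [RHS]mulrBr -[p * q * x]mulrA qx.
by rewrite -[q * p * x]mulrA px [p * _]mulrA px [q * _]mulrA qx -!mulrA.
Qed.

Lemma braid_comm p q x : p * x = x * p -> q * x = x * q ->
  (p * q * p - q * p * q) * x = x * (p * q * p - q * p * q).
Proof.
move=> px qx; have px' : GRing.comm x p by []; have qx' : GRing.comm x q by [].
by apply/esym/commrB; apply: commrM => //; apply: commrM.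
Qed.

Section Braid.
Variables (p q c1 c2 c3 : A).
Hypotheses (p1 : p * c1 = c2 * p) (p2 : (p + 1) * c2 = c1 * (p + 1)).
Hypotheses (q2 : q * c2 = c3 * q) (q3 : (q + 1) * c3 = c2 * (q + 1)).
Hypotheses (p3 : p * c3 = c3 * p) (q1 : q * c1 = c1 * q).
Hypotheses (pp : p * p = - p) (qq : q * q = - q).
Let E := p * q * p - q * p * q.

(** The defect [E] of the braid relation permutes the Clifford generators like the reversal of three
    strands: [c1] and [c3] are exchanged and [c2] is fixed. *)
Lemma braid_lo : E * c1 = c3 * E.
Proof.
rewrite /E mulrBl mulrBr; congr (_ - _); rewrite -!mulrA.
  by rewrite p1 [q * _]mulrA q2 !mulrA p3.
by rewrite q1 [p * (c1 * _)]mulrA p1 !mulrA q2.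
Qed.

Lemma braid_mid : E * c2 = c2 * E.
Proof.
have p2' := cross_hi p2; have q3' := cross_hi q3.
(* Both halves of [E] produce the same correction [c2 p q - c3 p q], which cancels in the
   difference. *)
have -> : E * c2 = (c2 * (p * q * p) + c2 * (p * q) - c3 * (p * q)) -
                  (c2 * (q * p * q) + c2 * (p * q) - c3 * (p * q)).
  rewrite /E mulrBl; congr (_ - _); rewrite -!mulrA.
    rewrite p2' !(mulrBr, mulrDr) !mulrA -[p * q * c1]mulrA q1 -[p * q * c2]mulrA q2.
    by rewrite !mulrA p1 p3.
  by rewrite q2 (mulrA p) p3 !mulrA q3' !(mulrBl, mulrDl) -!mulrA.
by rewrite opprB addrA subrK opprD [X in _ + X]addrC addrA addrK -mulrBr.
Qed.

Lemma braid_hi : E * c3 = c1 * E.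
Proof.
have p2' := cross_hi p2; have q3' := cross_hi q3.
(* The common lower-order part of [p q p c3] and [q p q c3], once the repeated factors [p p] and
   [q q] are reduced by the quadratic relations. *)
pose rest := c1 * (q * p) - c2 * (q * p) - c2 * p + c3 * p.
have L : p * q * p * c3 = c1 * (p * q * p) + rest.
  rewrite -!mulrA p3 (mulrA q) q3' !(mulrBl, mulrDl) !(mulrBr, mulrDr) !mulrA.
  rewrite p2' p3 -!mulrA !(mulrBl, mulrDl) -!mulrA pp !mulrN opprK.
  rewrite /rest -!addrA; congr (_ + (_ + (_ + _))).
  by rewrite addrA addNr add0r.
have R : q * p * q * c3 = c1 * (q * p * q) + rest.
  have Y : q * (p * c2) = c1 * (q * p) + (c1 * q - c3 * q).
    by rewrite p2' mulrBr mulrDr !mulrA q1 q2 -!addrA.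
  have Yq : (c1 * (q * p) + (c1 * q - c3 * q)) * q =
            c1 * (q * p * q) - (c1 * q - c3 * q).
    by rewrite mulrDl mulrBl -!mulrA qq !mulrN -opprD.
  rewrite -mulrA q3' mulrBr mulrDr -[q * p * (c2 * q)]mulrA (mulrA p) (mulrA q).
  rewrite -[q * p * c2]mulrA Y Yq addrACA addNr addr0.
  rewrite -[q * p * c3]mulrA p3 (mulrA q c3) q3' mulrBl mulrDl !opprD opprK.
  by rewrite /rest -!mulrA !addrA.
by rewrite /E mulrBl mulrBr L R opprD addrACA subrr addr0.
Qed.
End Braid.
End CrossRelations.

(** * Action on the unit of the Clifford algebra *)

Section Vacuum.
Variable A : pzRingType.
Variables (h c c' r r' p v : A).
Hypotheses (h2 : h + h = 1) (hC : forall x, h * x = x * h).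
Hypotheses (cc : c * c = -1) (cc' : c' * c' = -1) (c'c : c' * c = - (c * c')).
Hypotheses (rc : r * c = - (c * r)) (rc' : r * c' = - (c' * r)).
Hypotheses (r'c : r' * c = - (c * r')) (r'c' : r' * c' = - (c' * r')).
Hypotheses (rv : r * v = c * v) (r'v : r' * v = c' * v) (pv : p * v = v * p).

(** Right and left multiplication agree on the unit, so [(c - c') (r - r')] acts there as the square
    of [c - c'], which is -2. *)
Lemma cswap_vacuum : cswap h c c' r r' * v = v.
Proof.
rewrite /cswap mulNr -!mulrA [X in _ * (_ * X)]mulrBl rv r'v -mulrBl.
have sq : (c - c') * (c - c') = - (1 + 1).
  rewrite mulrBl !mulrBr cc cc' c'c opprB opprK.
  by rewrite addrACA addNr addr0 opprD.
rewrite [X in h * X]mulrA sq.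
by rewrite mulNr mulrN opprK mulrA mulrDr mulr1 h2 mul1r.
Qed.

(** The correction [a x - s(x) a] vanishes at [x = 1], leaving only the action on the second
    factor. *)
Lemma hecke_pi_vacuum : hecke_pi h c c' r r' p * v = p * v.
Proof.
have cv := cswap_vacuum.
have ev : (1 - r * r') * v = (1 - c * c') * v.
  rewrite !mulrBl -!mulrA r'v [r * _]mulrA rc' mulNr -mulrA rv mulrA c'c mulNr opprK.
  by rewrite -mulrA.
rewrite /hecke_pi mulrBl -mulrA [(p + _) * v]mulrDl -[h * _ * v]mulrA ev.
rewrite mulrDr pv mulrA cv -pv -addrA -[RHS]addr0; congr (_ + _).
rewrite mulrA -hC -!mulrA -mulrBr; apply/eqP; rewrite -[0](mulr0 h); apply/eqP.
congr (_ * _); rewrite mulrA mulrBr mulr1 mulrA.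
(* The exchange turns [1 - c c'] into [1 - c' c = 1 + c c'], which the last term of [hecke_pi]
   cancels. *)
rewrite (cswap_lo hC cc cc' c'c rc r'c).
rewrite -mulrA (cswap_hi hC cc cc' rc' r'c') mulrA c'c mulNr opprK.
rewrite mulrDl -mulrA cv mulrDl mul1r -mulrA subrr //.
Qed.
End Vacuum.

(** * Clifford operators on Fock space *)

Section SquareMatrices.
Variables (K : comPzRingType) (n : nat).
Implicit Types (a : K) (M N : 'M[K]_n).

Lemma mxscaleMl a M N : (a *: M) * N = a *: (M * N).
Proof. by rewrite [RHS]scalemxAl. Qed.

Lemma mxscaleMr a M N : M * (a *: N) = a *: (M * N).
Proof. by rewrite [RHS]scalemxAr. Qed.
End SquareMatrices.

Notation occupation n := {ffun 'I_n -> bool}.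

Section FockIndex.
Variable n : nat.
Implicit Types (x y z t : occupation n) (i j k : 'I_n).

Definition flip j x : occupation n := [ffun i => x i (+) (i == j)].
Definition vacuum : occupation n := [ffun=> false].
Definition parity x : bool := \big[addb/false]_i x i.

Lemma flipC i j x : flip i (flip j x) = flip j (flip i x).
Proof. by apply/ffunP => k; rewrite !ffunE addbAC. Qed.

Lemma flipK j : involutive (flip j).
Proof. by move=> x; apply/ffunP => k; rewrite !ffunE -addbA addbb addbF. Qed.

Lemma parity_flip j x : parity (flip j x) = ~~ parity x.
Proof.
rewrite /parity; under eq_bigr do rewrite ffunE; rewrite big_split /=.
rewrite (bigD1 j (F := fun i => i == j)) //= eqxx [X in true (+) X]big1 ?addbT //.
by move=> i /negbTE ->.
Qed.

Lemma parity_vacuum : parity vacuum = false.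
Proof. by rewrite /parity big1 // => i _; rewrite ffunE. Qed.

Variable K : comNzRingType.

(** The product is the sign for moving [c_j] past the smaller letters of [x]. For left
    multiplication a repeated [c_j] squares to -1, whence the last factor; for the signed right
    multiplication the parity sign of [x] absorbs it. *)
Definition fsign (b : bool) j x : K :=
  (\prod_(i < n | (i < j)%N) (-1) ^+ x i) * (-1) ^+ (b && x j).

Lemma fsign_flip b j k x :
  fsign b j (flip k x) = (-1) ^+ ((k < j)%N || b && (k == j)) * fsign b j x.
Proof.
have E : \prod_(i < n | (i < j)%N) (-1) ^+ flip k x i =
    (-1) ^+ (k < j)%N * \prod_(i < n | (i < j)%N) (-1) ^+ x i :> K.
  under eq_bigr do rewrite ffunE signr_addb.
  rewrite big_split mulrC; congr (_ * _) => /=.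
  case: (boolP (k < j)%N) => kj; last first.
    rewrite big1 // => i ij; case: eqP => // ik; by rewrite -ik ij in kj.
  by rewrite (bigD1 k) //= eqxx big1 ?mulr1 // => i /andP[_ /negbTE ->].
rewrite /fsign E !ffunE -!mulrA; case: (eqVneq k j) => [->|kj].
  rewrite ltnn expr0 mul1r andbT /=; case: b; rewrite /= ?mul1r //.
  by rewrite signr_addb expr1 mulrN1 mulrN mulN1r.
by rewrite andbF orbF addbF.
Qed.

Lemma fsign_sq b j x : fsign b j x * fsign b j x = 1.
Proof.
rewrite /fsign mulrACA -big_split big1 ?mul1r => [|i _ /=].
  by rewrite -expr2 sqrr_sign.
by rewrite -expr2 sqrr_sign.
Qed.

Lemma fsign_below b j x : (forall i, (i <= j)%N -> ~~ x i) -> fsign b j x = 1.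
Proof.
move=> h; rewrite /fsign (negbTE (h j (leqnn j))) andbF mulr1 big1 // => i ij.
by rewrite (negbTE (h i (ltnW ij))).
Qed.

Definition fdelta x y : 'M[K]_#|occupation n| :=
  delta_mx (enum_rank x) (enum_rank y).

(* On the basis of ordered monomials of Cl_n, [clifford true j] is the left
   multiplication by [c_j] and [clifford false j] is [x |-> (-1)^|x| x c_j]. *)
Definition clifford b j : 'M[K]_#|occupation n| :=
  \sum_x fsign b j x *: fdelta (flip j x) x.

Lemma fdeltaM x y z t :
  fdelta x y * fdelta z t = if y == z then fdelta x t else 0.
Proof.
rewrite /fdelta /GRing.mul /= mul_delta_mx_cond (inj_eq enum_rank_inj).
by case: eqP; rewrite ?mulr1n ?mulr0n.
Qed.

Lemma cliffordM b j x y :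
  clifford b j * fdelta x y = fsign b j x *: fdelta (flip j x) y.
Proof.
rewrite /clifford mulr_suml (bigD1 x) //= mxscaleMl fdeltaM eqxx big1 ?addr0 //.
by move=> z /negbTE zx; rewrite mxscaleMl fdeltaM zx scaler0.
Qed.

Lemma fdelta_sum : \sum_x fdelta x x = 1.
Proof.
rewrite /fdelta -[RHS]/(1%:M) mx1_sum_delta (reindex enum_rank) //=.
by apply: onW_bij; exists enum_val; [exact: enum_rankK|exact: enum_valK].
Qed.

Lemma fock_ext (M N : 'M[K]_#|occupation n|) :
  (forall x, M * fdelta x x = N * fdelta x x) -> M = N.
Proof.
move=> h; rewrite -[M]mulr1 -[N]mulr1 -fdelta_sum !mulr_sumr.
by apply: eq_bigr.
Qed.

(** A flip at [k] changes [fsign b j] when [k < j], or when [k = j] and [b] holds; under the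
    hypothesis exactly one of the two orders of application incurs such a sign. *)
Lemma clifford_anti b b' j k : (j != k) || (b != b') ->
  clifford b j * clifford b' k = - (clifford b' k * clifford b j).
Proof.
move=> h; apply: fock_ext => x; rewrite mulNr -!mulrA !cliffordM !mxscaleMr.
rewrite !cliffordM !scalerA flipC -scaleNr; congr (_ *: _).
rewrite !fsign_flip -mulrN -mulNr [LHS]mulrCA [RHS]mulrCA [fsign b' k x * _]mulrC.
congr (_ * _); rewrite -signrN; congr (_ ^+ _); move: h.
have [->|jk _] /= := eqVneq j k; first by rewrite ltnn !andbT; case: b b' => [] [].
by rewrite !andbF !orbF; move: jk; rewrite -val_eqE /=; case: ltngtP.
Qed.

Lemma clifford_sq j : clifford true j * clifford true j = -1.
Proof.
apply: fock_ext => x; rewrite -mulrA cliffordM mxscaleMr cliffordM scalerA.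
by rewrite fsign_flip flipK eqxx orbT mulrCA fsign_sq mulr1 scaleN1r mulN1r.
Qed.

Lemma clifford_vacuum b j y :
  clifford b j * fdelta vacuum y = fdelta (flip j vacuum) y.
Proof.
by rewrite cliffordM fsign_below ?scale1r // => i _; rewrite ffunE.
Qed.

Definition occ (l : seq 'I_n) : occupation n := [ffun i => i \in l].

(** The largest letter acts first, so each new letter lies below all occupied places and contributes
    no sign. *)
Lemma clifford_word l y : sorted (fun i j : 'I_n => i < j)%N l ->
  (\prod_(j <- l) clifford true j) * fdelta vacuum y = fdelta (occ l) y.
Proof.
elim: l => [|j l IH] hl.
  by rewrite big_nil mul1r; congr (fdelta _ _); apply/ffunP => i; rewrite !ffunE.
have /allP jl := order_path_min (fun i k m : 'I_n => @ltn_trans i k m) hl.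
rewrite big_cons -mulrA IH ?(path_sorted hl) // cliffordM.
rewrite fsign_below ?scale1r => [|i ij]; last first.
  by rewrite ffunE; apply/negP => /jl; rewrite ltnNge ij.
congr (fdelta _ _); apply/ffunP => i; rewrite !ffunE inE.
case: eqP => [->|_]; last by rewrite addbF.
by rewrite addbT orTb; apply/negP => /jl; rewrite ltnn.
Qed.
End FockIndex.

(** * The action on the tensor product of Cl_n and N *)

Section VacuumProducts.
Variables (A : pzRingType) (I : Type) (f g : I -> A) (v : A).
Hypotheses (fv : forall i, f i * v = g i * v) (gv : forall i, g i * v = v * g i).

(** The factor next to [v] becomes a [g], which moves to the right of [v] and exposes the next
    [f]. *)
Lemma vacuum_prod2 i j : f i * f j * v = g i * g j * v.
Proof. by rewrite -mulrA fv gv mulrA fv -mulrA -gv mulrA. Qed.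

Lemma vacuum_prod3 i j k : f i * f j * f k * v = g i * g j * g k * v.
Proof.
have ggv : g j * g k * v = v * (g j * g k) by rewrite -mulrA gv mulrA gv -mulrA.
by rewrite -!mulrA [f j * _]mulrA vacuum_prod2 ggv mulrA fv -mulrA -ggv !mulrA.
Qed.
End VacuumProducts.

Section Tensor.
Variable K : comPzRingType.

Lemma tensmxNl m n p q (M : 'M[K]_(m, n)) (N : 'M[K]_(p, q)) :
  (- M) *t N = - (M *t N).
Proof. by apply/matrixP => i j; rewrite !mxE mulNr. Qed.

Lemma tensmxNr m n p q (M : 'M[K]_(m, n)) (N : 'M[K]_(p, q)) :
  M *t (- N) = - (M *t N).
Proof. by apply/matrixP => i j; rewrite !mxE mulrN. Qed.

Lemma tensmx_suml (I : finType) m n p q (M : I -> 'M[K]_(m, n)) (N : 'M[K]_(p, q)) :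
  (\sum_i M i) *t N = \sum_i (M i *t N).
Proof.
apply/matrixP => i j; rewrite !mxE !summxE mulr_suml.
by apply: eq_bigr => k _; rewrite mxE.
Qed.

Lemma tensmx1 m n : (1%:M : 'M[K]_m) *t (1%:M : 'M[K]_n) = 1%:M.
Proof.
apply/matrixP => i j; case: (mxtens_indexP i) => i0 i1.
case: (mxtens_indexP j) => j0 j1; rewrite tensmxE !mxE -natrM mulnb.
by rewrite (can_eq (@mxtens_indexK _ _)) -pair_eqE.
Qed.

Lemma tensmxM m n (M N : 'M[K]_m) (M' N' : 'M[K]_n) :
  (M *t M') * (N *t N') = (M * N) *t (M' * N').
Proof. exact: tensmx_mul. Qed.
End Tensor.

Section InducedRepresentation.
Variables (K : fieldType) (n d : nat).
Hypothesis K2 : 2%:R != 0 :> K.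
Variable P : 'I_n.-1 -> 'M[K]_d.
Hypothesis hP : H0_relations P.

Local Notation D := (#|occupation n| * d)%N.
Implicit Types (i : 'I_n.-1) (j k : 'I_n).

Definition ind_cl b j : 'M[K]_D := clifford K b j *t 1%:M.
Definition ind_p i : 'M[K]_D := 1%:M *t P i.
Definition ind_pi i : 'M[K]_D :=
  hecke_pi (2%:R^-1)%:M (ind_cl true (lo i)) (ind_cl true (hi i))
    (ind_cl false (lo i)) (ind_cl false (hi i)) (ind_p i).
(** The rank-one operator from monomial [y] to monomial [x], tensored with the identity. Square
    matrices in place of vectors keep the vacuum identities inside one ring. *)
Definition ind_state x y : 'M[K]_D := fdelta K x y *t 1%:M.
Let c := ind_cl true.
Let v := ind_state (vacuum n) (vacuum n).

Let half2 : (2%:R^-1)%:M + (2%:R^-1)%:M = 1 :> 'M[K]_D.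
Proof.
by rewrite -rmorphD -[2%:R^-1]mul1r -mulrDl -[1 + 1]/(2%:R) divff // rmorph1.
Qed.

Let halfC (x : 'M[K]_D) : (2%:R^-1)%:M * x = x * (2%:R^-1)%:M.
Proof. exact: scalar_mx_central. Qed.

Lemma ind_cl_anti b b' j k : (j != k) || (b != b') ->
  ind_cl b j * ind_cl b' k = - (ind_cl b' k * ind_cl b j).
Proof. by move=> h; rewrite /ind_cl !tensmxM clifford_anti // tensmxNl. Qed.

Lemma ind_cl_sq j : c j * c j = -1.
Proof. by rewrite /c /ind_cl tensmxM clifford_sq tensmxNl mulr1 tensmx1. Qed.

Lemma ind_p_cl i b j : ind_p i * ind_cl b j = ind_cl b j * ind_p i.
Proof. by rewrite /ind_cl /ind_p !tensmxM !mul1r !mulr1. Qed.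

Lemma ind_cl_vacuum b j y :
  ind_cl b j * ind_state (vacuum n) y = ind_state (flip j (vacuum n)) y.
Proof. by rewrite /ind_cl /ind_state tensmxM clifford_vacuum mulr1. Qed.

Lemma ind_p_state i x y : ind_p i * ind_state x y = ind_state x y * ind_p i.
Proof. by rewrite /ind_state /ind_p !tensmxM !mul1r !mulr1. Qed.

Let lohi i : hi i != lo i. Proof. by rewrite eq_sym lo_neq_hi. Qed.

Lemma ind_pi_lo i : ind_pi i * c (lo i) = c (hi i) * ind_pi i.
Proof.
by apply: hecke_pi_lo; rewrite ?ind_cl_sq ?ind_p_cl //;
   apply: ind_cl_anti; rewrite ?lohi ?orbT.
Qed.

Lemma ind_pi_hi i : (ind_pi i + 1) * c (hi i) = c (lo i) * (ind_pi i + 1).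
Proof.
by apply: hecke_pi_hi; rewrite ?ind_cl_sq ?ind_p_cl //;
   apply: ind_cl_anti; rewrite ?lohi ?orbT.
Qed.

Lemma ind_pi_comm i j : j != lo i -> j != hi i ->
  ind_pi i * c j = c j * ind_pi i.
Proof.
rewrite eq_sym => jl; rewrite eq_sym => jh.
by apply: hecke_pi_comm; rewrite ?ind_p_cl //; apply: ind_cl_anti;
   rewrite ?jl ?jh ?orbT.
Qed.

Lemma ind_pi_vacuum i : ind_pi i * v = ind_p i * v.
Proof.
by apply: hecke_pi_vacuum;
   rewrite ?ind_cl_sq ?ind_p_cl ?ind_cl_vacuum ?ind_p_state //;
   apply: ind_cl_anti; rewrite ?lohi ?orbT.
Qed.

Definition ordlt : rel 'I_n := fun j k => (j < k)%N.

Lemma ind_word (l : seq 'I_n) y : sorted ordlt l ->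
  (\prod_(j <- l) c j) * ind_state (vacuum n) y = ind_state (occ l) y.
Proof.
move=> hl; rewrite /ind_state -(clifford_word _ _ hl) -[1%:M in RHS]mulr1 -tensmxM.
congr (_ * _); elim: l {hl} => [|j l IH]; rewrite ?big_nil ?tensmx1 //.
by rewrite !big_cons IH /c /ind_cl tensmxM mulr1.
Qed.

Definition occ_seq (x : occupation n) := [seq j <- enum 'I_n | x j].

Lemma occ_seqK x : occ (occ_seq x) = x.
Proof. by apply/ffunP => j; rewrite ffunE mem_filter mem_enum andbT. Qed.

Lemma occ_seq_sorted x : sorted ordlt (occ_seq x).
Proof.
apply: sorted_filter; first by move=> i j k; apply: ltn_trans.
have := iota_ltn_sorted 0 n; rewrite -val_enum_ord sorted_map.
by apply: sub_sorted.
Qed.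

(* Reduces each relation between the [ind_pi i] to an identity on the vacuum
   together with the fact that its defect moves past every [c j]. *)
Lemma ind_ext (E : 'M[K]_D) : (forall j, exists y, E * c j = y * E) ->
  E * v = 0 -> E = 0.
Proof.
move=> hE Ev.
have Ew l : exists y, E * \prod_(j <- l) c j = y * E.
  elim: l => [|j l [y IH]]; first by exists 1; rewrite big_nil mulr1 mul1r.
  have [z hz] := hE j.
  by exists (z * y); rewrite big_cons mulrA hz -mulrA IH mulrA.
have Ex x : E * ind_state x (vacuum n) = 0.
  rewrite -(occ_seqK x) -ind_word ?occ_seq_sorted // mulrA.
  by have [y ->] := Ew (occ_seq x); rewrite -mulrA Ev mulr0.
rewrite -[E]mulr1 -[1](tensmx1 _ #|occupation n| d) -[1%:M in X in E * X]fdelta_sum.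
rewrite tensmx_suml mulr_sumr big1 // => x _.
(* Each summand of the identity factors through the vacuum. *)
have -> : fdelta K x x *t 1%:M = ind_state x (vacuum n) * ind_state (vacuum n) x.
  by rewrite /ind_state tensmxM fdeltaM eqxx mulr1.
by rewrite mulrA Ex mul0r.
Qed.

Lemma ind_p_relations : H0_relations ind_p.
Proof.
have [h1 h2 h3] := hP; split=> [i|i j ij|i j ij]; rewrite /ind_p !tensmxM.
- by rewrite mul1r h1 tensmxNr.
- by rewrite h2.
- by rewrite h3.
Qed.

Let v2 := vacuum_prod2 ind_pi_vacuum (fun i => ind_p_state i _ _).
Let v3 := vacuum_prod3 ind_pi_vacuum (fun i => ind_p_state i _ _).

Lemma ind_pi_sq i : ind_pi i * ind_pi i = - ind_pi i.
Proof.
have [pp _ _] := ind_p_relations; apply/eqP; rewrite -addr_eq0.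
apply/eqP/ind_ext.
  move=> j; have [->|jl] := eqVneq j (lo i).
    by exists (c (lo i)); apply: quad_lo (ind_pi_lo i) (ind_pi_hi i).
  have [->|jh] := eqVneq j (hi i).
    by exists (c (hi i)); apply: quad_hi (ind_pi_lo i) (ind_pi_hi i).
  by exists (c j); apply: quad_comm; apply: ind_pi_comm.
by rewrite mulrDl v2 ind_pi_vacuum pp mulNr addNr.
Qed.

Lemma ind_pi_far (i j : 'I_n.-1) : (i.+1 < j)%N || (j.+1 < i)%N ->
  ind_pi i * ind_pi j = ind_pi j * ind_pi i.
Proof.
move=> ij; have [_ pp _] := ind_p_relations; apply/eqP; rewrite -subr_eq0; apply/eqP.
have ne k : (k == lo i) || (k == hi i) -> (k != lo j) && (k != hi j).
  by rewrite -!val_eqE /=; lia.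
have /andP[l1 l2] := ne (lo i) (introT orP (or_introl (eqxx _))).
have /andP[l3 l4] := ne (hi i) (introT orP (or_intror (eqxx _))).
apply: ind_ext.
  move=> k; have [->|kl] := eqVneq k (lo i).
    exists (c (hi i)); apply: commutator_lo (ind_pi_lo i) _ _; exact: ind_pi_comm.
  have [->|kh] := eqVneq k (hi i).
    exists (c (lo i)); apply: commutator_hi (ind_pi_hi i) _ _; exact: ind_pi_comm.
  (* The commutator is antisymmetric, so the generators moved by [ind_pi j] are treated with the
     roles of [i] and [j] exchanged. *)
  rewrite -opprB; have [->|kl'] := eqVneq k (lo j).
    exists (c (hi j)); rewrite mulNr mulrN; congr (- _).
    by apply: commutator_lo (ind_pi_lo j) _ _; apply: ind_pi_comm; rewrite eq_sym.
  have [->|kh'] := eqVneq k (hi j).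
    exists (c (lo j)); rewrite mulNr mulrN; congr (- _).
    by apply: commutator_hi (ind_pi_hi j) _ _; apply: ind_pi_comm; rewrite eq_sym.
  exists (c k); rewrite mulNr mulrN; congr (- _).
  by apply: commutator_comm; exact: ind_pi_comm.
by rewrite mulrBl [X in X - _]v2 [X in _ - X]v2 (pp _ _ ij) subrr.
Qed.

Lemma ind_pi_braid (i j : 'I_n.-1) : j = i.+1 :> nat ->
  ind_pi i * ind_pi j * ind_pi i = ind_pi j * ind_pi i * ind_pi j.
Proof.
move=> ij; have [_ _ pp] := ind_p_relations; apply/eqP; rewrite -subr_eq0; apply/eqP.
have lj : lo j = hi i by apply: val_inj; rewrite /= ij.
have p1 := ind_pi_lo i; have p2 := ind_pi_hi i.
have := ind_pi_lo j; rewrite lj => q2; have := ind_pi_hi j; rewrite lj => q3.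
have p3 : ind_pi i * c (hi j) = c (hi j) * ind_pi i.
  by apply: ind_pi_comm; rewrite -val_eqE /= ij; lia.
have q1 : ind_pi j * c (lo i) = c (lo i) * ind_pi j.
  by apply: ind_pi_comm; rewrite -val_eqE /= ij; lia.
apply: ind_ext => [k|].
  have [->|kl] := eqVneq k (lo i).
    by exists (c (hi j)); apply: braid_lo p1 q2 p3 q1.
  have [->|km] := eqVneq k (hi i).
    by exists (c (hi i)); apply: braid_mid p1 p2 q2 q3 p3 q1.
  have [->|kh] := eqVneq k (hi j).
    exists (c (lo i)).
    exact: (braid_hi p2 q2 q3 p3 q1 (ind_pi_sq i) (ind_pi_sq j)).
  exists (c k); apply: braid_comm; first exact: ind_pi_comm.
  by apply: ind_pi_comm; rewrite ?lj.
by rewrite mulrBl [X in X - _]v3 [X in _ - X]v3 (pp _ _ ij) subrr.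
Qed.
End InducedRepresentation.

(** * Presented modules and Clifford words *)

Lemma palg_ind (K : comNzRingType) (X : Type) (R : aterm K X -> aterm K X -> Prop)
    (Q : palg R -> Prop) :
  (forall a, Q (pconst R a)) -> (forall x, Q (pgen R x)) ->
  (forall x y, Q x -> Q y -> Q (x + y)) ->
  (forall x y, Q x -> Q y -> Q (x * y)) -> forall x, Q x.
Proof.
move=> hk hg hD hM; elim/palgP => t; elim: t => [x|a|s IHs t IHt|s IHs t IHt].
- exact: hg.
- exact: hk.
- by rewrite piD; apply: hD.
- by rewrite piM; apply: hM.
Qed.

Section ModuleLift.
Variables (A : pzRingType) (X : Type) (R : mterm A X -> mterm A X -> Prop).
Variables (V : lmodType A) (g : X -> V).

Fixpoint meval (t : mterm A X) : V :=
  match t with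
  | MGen x => g x
  | MZero => 0
  | MAdd s t => meval s + meval t
  | MScale a s => a *: meval s
  end.

Hypothesis sound : forall s t, R s t -> meval s = meval t.

Lemma meval_cong s t : mcong R s t -> meval s = meval t.
Proof.
elim=> {s t} //=.
- by move=> t s u _ -> _ ->.
- by move=> s s' t t' _ -> _ ->.
- by move=> a s s' _ ->.
- by move=> *; rewrite addrA.
- by move=> *; rewrite addrC.
- by move=> *; rewrite add0r.
- by move=> *; rewrite scale0r.
- by move=> *; rewrite scale1r.
- by move=> *; rewrite scalerA.
- by move=> *; rewrite scalerDr.
- by move=> *; rewrite scalerDl.
Qed.

Local Notation mpi :=
  (qpi (@mcong_refl _ _ R) (@mcong_sym _ _ R) (@mcong_trans _ _ R)).
Definition pmod_lift (x : pmod R) : V :=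
  meval (qrepr (Erefl := @mcong_refl _ _ R) (Esym := @mcong_sym _ _ R)
               (Etrans := @mcong_trans _ _ R) x).

Lemma pmod_lift_pi t : pmod_lift (mpi t) = meval t.
Proof. by apply: meval_cong; apply: qrepr_pi. Qed.

Lemma pmod_lift_gen x : pmod_lift (mgen R x) = g x.
Proof. exact: pmod_lift_pi. Qed.

Lemma pmod_lift_is_linear : linear pmod_lift.
Proof.
move=> a; elim/pmodP => s; elim/pmodP => t.
rewrite [_ + _ in LHS](_ : _ = madd (mscale a (mpi s)) (mpi t)) //.
by rewrite -mpiZ -mpiD !pmod_lift_pi.
Qed.
Definition pmod_lift_linear : {linear pmod R -> V} :=
  HB.pack pmod_lift
    (GRing.isLinear.Build A (pmod R) V *:%R pmod_lift pmod_lift_is_linear).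
End ModuleLift.

Lemma pmod_ind (A : pzRingType) (X : Type) (R : mterm A X -> mterm A X -> Prop)
    (Q : pmod R -> Prop) :
  (forall x, Q (mgen R x)) -> Q 0 -> (forall x y, Q x -> Q y -> Q (x + y)) ->
  (forall a x, Q x -> Q (a *: x)) -> forall x, Q x.
Proof.
move=> hg h0 hD hZ; elim/pmodP => t; elim: t => [x||s IHs t IHt|a s IHs].
- exact: hg.
- exact: h0.
- by rewrite mpiD; apply: hD.
- by rewrite mpiZ; apply: hZ.
Qed.

Section TensorProduct.
Variables (K : comNzRingType) (n : nat) (N : lmodType (H0 K n)).
Implicit Types (a b : HCl K n) (v w : N).

Lemma tensorDr a v w : tensor a (v + w) = tensor a v + tensor a w.
Proof. by rewrite /tensor /mgen (mpi_eq (mcong_rel (tensor_addr a v w))) mpiD. Qed.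

Lemma tensor_bal a h v : tensor (a * H0_HCl K n h) v = tensor a (h *: v).
Proof. by rewrite /tensor /mgen (mpi_eq (mcong_rel (tensor_balance a h v))). Qed.

Lemma tensorZl b a v : b *: tensor a v = tensor (b * a) v.
Proof.
rewrite /tensor /mgen -(mpi_eq (mcong_rel (tensor_act b a v))) [RHS]mpiZ //.
Qed.

Lemma tensor0r a : tensor a (0 : N) = 0.
Proof. by apply: (addrI (tensor a 0)); rewrite -tensorDr !addr0. Qed.

Lemma H0_HCl_const k : H0_HCl K n (pconst _ k) = hk K n k.
Proof. exact: (plift_const (@pconstC _ _ _) (@H0_HCl_sound K n)). Qed.

Lemma H0_HCl_gen i : H0_HCl K n (pgen _ i) = hpi K i.
Proof. exact: (plift_gen (@pconstC _ _ _) (@H0_HCl_sound K n)). Qed.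

Lemma tensor_scalar k a v : tensor a (pconst _ k *: v) = hk K n k *: tensor a v.
Proof.
rewrite -tensor_bal H0_HCl_const tensorZl; congr (tensor _ _).
exact/esym/pconstC.
Qed.
End TensorProduct.

Section HClRelations.
Variables (K : comNzRingType) (n : nat).
Local Notation hc := (@hc K n).
Local Notation hpi := (@hpi K n).
Local Notation hk := (hk K n).

Lemma hc_sq j : hc j * hc j = -1.
Proof.
have := palg_rel (HCl_sq K j); rewrite piM => h; apply: etrans h _.
by rewrite -[LHS]/(hk (-1)) rmorphN1.
Qed.

Lemma hc_anti i j : i != j -> hc i * hc j = - (hc j * hc i).
Proof.
move=> ij; have := palg_rel (HCl_anti K ij); rewrite !piM => h.
apply: etrans h _.
by rewrite -[LHS]/(hk (-1) * (hc j * hc i)) rmorphN1 mulN1r.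
Qed.

Lemma hpi_comm i j : j != lo i -> j != hi i -> hpi i * hc j = hc j * hpi i.
Proof. by move=> jl jh; have := palg_rel (HCl_comm K jl jh); rewrite !piM. Qed.

Lemma hpi_lo i : hpi i * hc (lo i) = hc (hi i) * hpi i.
Proof. by have := palg_rel (HCl_lo K i); rewrite !piM. Qed.

Lemma hpi_hi i : (hpi i + 1) * hc (hi i) = hc (lo i) * (hpi i + 1).
Proof. by have := palg_rel (HCl_hi K i); rewrite !piM !piD. Qed.

Lemma hkC a x : hk a * x = x * hk a.
Proof. exact: pconstC. Qed.

Definition cword (l : seq 'I_n) : HCl K n := \prod_(j <- l) hc j.

Lemma cword_nil : cword [::] = 1.
Proof. exact: big_nil. Qed.

(** Insertion with signs: [c_j] moves right past smaller letters and cancels against an equal one.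
    The inclusion of letters keeps the head of the word smallest in the induction. *)
Lemma cword_insert j l : sorted (@ordlt n) l -> exists e l',
  [/\ sorted (@ordlt n) l', {subset l' <= j :: l} &
      hc j * cword l = (-1) ^+ e * cword l'].
Proof.
have ltT : transitive (@ordlt n) by move=> a b c; apply: ltn_trans.
elim: l => [|k l IH] kl.
  by exists 0%N, [:: j]; split; rewrite ?mul1r // /cword big_seq1 big_nil mulr1.
have [jk|kj|jk] := ltngtP j k.
- exists 0%N, [:: j, k & l]; split=> //; first by rewrite /= {1}/ordlt jk.
  by rewrite mul1r /cword !big_cons.
- have [e [l' [sl' ll' E]]] := IH (path_sorted kl); exists e.+1, (k :: l'); split.
  + rewrite /= (path_sortedE ltT) sl' andbT; apply/allP => m /ll'.
    rewrite inE => /orP[/eqP -> //|].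
    by have := kl; rewrite /= (path_sortedE ltT) => /andP[/allP h _] /h.
  + move=> m; rewrite !inE => /orP[-> |/ll']; rewrite ?orbT //.
    by rewrite inE => /orP[->|->]; rewrite ?orbT.
  rewrite /cword !big_cons mulrA hc_anti; last by rewrite -val_eqE gtn_eqF.
  rewrite mulNr -mulrA E exprS mulN1r mulNr !mulrA; congr (- (_ * _)).
  exact/commr_sign.
- exists 1%N, l; split; first exact: path_sorted kl.
    by move=> m; rewrite !inE => ->; rewrite !orbT.
  by rewrite /cword big_cons (ord_inj jk) mulrA hc_sq expr1.
Qed.

Lemma homog_cword l : homog (\big[addb/false]_(j <- l) true) (cword l).
Proof.
rewrite /cword; elim: l => [|j l IH]; last first.
  by rewrite !big_cons; apply: homog_mul IH; apply: homog_c.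
by rewrite !big_nil -(rmorph1 hk); apply: homog_const.
Qed.
End HClRelations.

(** * The induced supermodule *)

Section HomogeneousMatrices.
Variables (K : fieldType) (m : nat) (deg : 'I_m -> bool).
Implicit Types (M N : 'M[K]_m).

Definition mxhomog (e : bool) M :=
  forall s t, M s t != 0 -> deg s = e (+) deg t.

Lemma mxhomogD e M N : mxhomog e M -> mxhomog e N -> mxhomog e (M + N).
Proof.
move=> hM hN s t; rewrite mxE; have [M0|/hM //] := eqVneq (M s t) 0.
by rewrite M0 add0r => /hN.
Qed.

Lemma mxhomogN e M : mxhomog e M -> mxhomog e (- M).
Proof. by move=> hM s t; rewrite mxE oppr_eq0 => /hM. Qed.

Lemma mxhomog_scalar a : mxhomog false a%:M.
Proof. by move=> s t; rewrite mxE; case: (eqVneq s t) => [->|_]; rewrite ?eqxx. Qed.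

Lemma mulmx_support (p q : nat) (M : 'M[K]_(p, m)) (N : 'M[K]_(m, q)) s t :
  (M *m N) s t != 0 -> exists k, (M s k != 0) && (N k t != 0).
Proof.
rewrite mxE => h; apply/existsP; apply: contraR h => /existsPn h.
rewrite big1 // => k _; apply/eqP.
by have := h k; rewrite negb_and !negbK mulf_eq0.
Qed.

Lemma mxhomogM e e' M N : mxhomog e M -> mxhomog e' N -> mxhomog (e (+) e') (M * N).
Proof.
move=> hM hN s t /mulmx_support[k /andP[/hM -> /hN ->]].
by rewrite addbA.
Qed.
End HomogeneousMatrices.

Section InducedSupermodule.
Variables (K : fieldType) (n d : nat).
Hypothesis K2 : 2%:R != 0 :> K.
Variable P : 'I_n.-1 -> 'M[K]_d.
Hypothesis hP : H0_relations P.

Local Notation D := (#|occupation n| * d)%N.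
Local Notation c := (@ind_cl K n d true).

Definition ind_gen (x : 'I_n.-1 + 'I_n) : 'M[K]_D :=
  match x with inl i => ind_pi P i | inr j => c j end.

Lemma ind_sound s t : HCl_rel s t ->
  aeval (scalar_mx : {rmorphism K -> 'M_D}) ind_gen s =
  aeval (scalar_mx : {rmorphism K -> 'M_D}) ind_gen t.
Proof.
case=> {s t} [s t|j|i j ij|i j jl jh|i|i] /=; rewrite ?rmorphN1 ?rmorph1 ?mulN1r.
- case=> [i|i j ij|i j ij] /=; rewrite ?rmorphN1 ?mulN1r.
  + exact: ind_pi_sq.
  + exact: ind_pi_far.
  + exact: ind_pi_braid.
- exact: ind_cl_sq.
- by apply: ind_cl_anti; rewrite ij.
- exact: ind_pi_comm.
- exact: ind_pi_lo.
- exact: ind_pi_hi.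
Qed.

Definition ind_rho : {rmorphism HCl K n -> 'M[K]_D} :=
  plift_rmorphism (@scalar_mx_central _ _) ind_sound.

Lemma ind_rho_const a : ind_rho (hk K n a) = a%:M.
Proof. exact: (plift_const (@scalar_mx_central _ _) ind_sound). Qed.

Lemma ind_rho_pi i : ind_rho (hpi K i) = ind_pi P i.
Proof. exact: (plift_gen (@scalar_mx_central _ _) ind_sound). Qed.

Lemma ind_rho_c j : ind_rho (hc K j) = c j.
Proof. exact: (plift_gen (@scalar_mx_central _ _) ind_sound). Qed.

Definition ind_deg (k : 'I_D) : bool := parity (enum_val (mxtens_unindex k).1).

Lemma mxhomog_cl b j : mxhomog ind_deg true (ind_cl K d b j).
Proof.
move=> s t; case: (mxtens_indexP s) => s0 s1; case: (mxtens_indexP t) => t0 t1.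
rewrite /ind_deg tensmxE !mxtens_indexK mulf_eq0 negb_or => /andP[+ _] /=.
rewrite /clifford summxE => h.
have /existsP[x] : [exists x, (fsign K b j x *: fdelta K (flip j x) x) s0 t0 != 0].
  apply: contraR h => /existsPn h; rewrite big1 // => x _; apply/eqP.
  by have := h x; rewrite negbK.
rewrite !mxE; case: (eqVneq s0 _) => [->|_]; last by rewrite mulr0 eqxx.
case: (eqVneq t0 _) => [->|_]; last by rewrite mulr0 eqxx.
by rewrite !enum_rankK parity_flip.
Qed.

Lemma mxhomog_p i : mxhomog ind_deg false (ind_p P i).
Proof.
move=> s t; case: (mxtens_indexP s) => s0 s1; case: (mxtens_indexP t) => t0 t1.
rewrite /ind_deg tensmxE !mxtens_indexK mulf_eq0 negb_or => /andP[+ _] /=.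
by rewrite mxE; case: (eqVneq s0 t0) => [->|_]; rewrite ?eqxx.
Qed.

(** Clifford operators enter [hecke_pi] only through products of two odd factors. *)
Lemma mxhomog_pi i : mxhomog ind_deg false (ind_pi P i).
Proof.
have hsc a : mxhomog ind_deg false (a%:M : 'M[K]_D) by apply: mxhomog_scalar.
have h1 : mxhomog ind_deg false (1 : 'M[K]_D) := hsc 1.
have hM e e' M N := @mxhomogM K _ ind_deg e e' M N.
rewrite /ind_pi /hecke_pi /cswap; apply: mxhomogD.
  apply: (hM false false).
    apply: mxhomogN; apply: (hM false false) => //.
    have hB b j k : mxhomog ind_deg true (ind_cl K d b j - ind_cl K d b k).
      by apply: mxhomogD; last apply: mxhomogN; apply: mxhomog_cl.
    by apply: (hM true true); apply: hB.
  apply: mxhomogD; first exact: mxhomog_p.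
  apply: (hM false false) => //; apply: mxhomogD => //; apply: mxhomogN.
  by apply: (hM true true); apply: mxhomog_cl.
apply: mxhomogN; apply: (hM false false) => //; apply: mxhomogD => //.
by apply: (hM true true); apply: mxhomog_cl.
Qed.

Lemma ind_rho_homog e x s t : homog e x -> ind_rho x s t != 0 ->
  ind_deg s = e (+) ind_deg t.
Proof.
move=> h; move: s t; rewrite -/(mxhomog ind_deg e (ind_rho x)).
elim: h => {e x} [a|i|j|e x y _ hx _ hy|e e' x y _ hx _ hy].
- by rewrite ind_rho_const; apply: mxhomog_scalar.
- by rewrite ind_rho_pi; apply: mxhomog_pi.
- by rewrite ind_rho_c; apply: mxhomog_cl.
- by rewrite rmorphD; apply: mxhomogD.
- by rewrite rmorphM; apply: mxhomogM.
Qed.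

Definition ind_smodule : smodule K n := SModule ind_rho_const ind_rho_homog.
End InducedSupermodule.

Lemma mxact_scale (K : comNzRingType) (A : pzRingType) d
    (rho : {rmorphism A -> 'M[K]_d}) (a : A) (v : mxmod rho) :
  a *: v = rho a *m (v : 'cV[K]_d).
Proof. by []. Qed.

(** * Isomorphism between the Fock space model and the induced module *)

Section InducedModel.
Variables (K : fieldType) (n d : nat).
Hypothesis K2 : 2%:R != 0 :> K.
Variable P : 'I_n.-1 -> 'M[K]_d.
Hypothesis hP : H0_relations P.

Local Notation D := (#|occupation n| * d)%N.
Let N : lmodType (H0 K n) := mxmod (H0_rep hP).
Local Notation X := (ind_smodule K2 hP).
Local Notation rho := (ind_rho K2 hP).
Local Notation vac := (vacuum n).

(** The pure tensor of the monomial [x] and [v]. A tensor product of columns has [1 * 1] columns,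
    which is convertible to 1. *)
Definition ket (x : occupation n) (v : 'cV[K]_d) : 'M[K]_(D, 1 * 1) :=
  delta_mx (enum_rank x) (0 : 'I_1) *t v.

Lemma ketD x v w : ket x (v + w) = ket x v + ket x w.
Proof. by apply/matrixP => i j; rewrite !mxE mulrDr. Qed.

Lemma ind_state_ket x y v : ind_state K d x y *m ket y v = ket x v.
Proof. by rewrite /ind_state /ket tensmx_mul mul_delta_mx mul1mx. Qed.

Lemma ind_p_ket i x v : ind_p P i *m ket x v = ket x (P i *m v).
Proof. by rewrite /ind_p /ket tensmx_mul mul1mx. Qed.

Lemma ind_pi_ket i v : ind_pi P i *m ket vac v = ket vac (P i *m v).
Proof.
rewrite -[in LHS](ind_state_ket _ vac) mulmxA.
rewrite -[ind_pi P i *m _]/(ind_pi P i * _) ind_pi_vacuum //.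
by rewrite -[_ * _]/(_ *m _) -mulmxA ind_state_ket ind_p_ket.
Qed.

(** By [ind_pi_ket] the vacuum vectors form a copy of the given module; this makes [tensor_eval]
    balanced. *)
Lemma ind_rho_ket h v : rho (H0_HCl K n h) *m ket vac v = ket vac (H0_rep hP h *m v).
Proof.
move: v; elim/palg_ind: h => [a|i|x y hx hy|x y hx hy] v.
- rewrite H0_HCl_const ind_rho_const.
  rewrite (_ : H0_rep hP _ = a%:M); last first.
    exact: (plift_const (@scalar_mx_central _ _) (H0_rep_sound hP)).
  by rewrite !mul_scalar_mx; apply/matrixP => i j; rewrite !mxE mulrCA.
- rewrite H0_HCl_gen ind_rho_pi ind_pi_ket; congr (ket _ (_ *m _)).
  exact/esym/(plift_gen (@scalar_mx_central _ _) (H0_rep_sound hP)).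
- by rewrite !rmorphD !mulmxDl hx hy ketD.
- by rewrite !rmorphM -!mulmxA hy hx.
Qed.

Lemma cword_ket l v : sorted (@ordlt n) l ->
  rho (cword K l) *m ket vac v = ket (occ l) v.
Proof.
move=> hl; rewrite /cword rmorph_prod; under eq_bigr do rewrite ind_rho_c.
rewrite -[in LHS](ind_state_ket _ vac) mulmxA.
rewrite -[(\prod_(_ <- _) _) *m _]/((\prod_(j <- l) ind_cl K d true j) * _).
by rewrite ind_word // ind_state_ket.
Qed.

Definition tensor_eval (t : HCl K n * N) : scarrier X := rho t.1 *m ket vac t.2.

Lemma tensor_evalE a v : tensor_eval (a, v) = rho a *m ket vac v.
Proof. by []. Qed.

Lemma tensor_eval_sound s t : tensor_rel s t ->
  meval tensor_eval s = meval tensor_eval t.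
Proof.
case=> [a b v|a v w|a h v|b a v] /=; rewrite !tensor_evalE.
- by rewrite rmorphD mulmxDl.
- by rewrite ketD mulmxDr.
- by rewrite rmorphM -mulmxA ind_rho_ket.
- by rewrite mxact_scale mulmxA -[_ *m rho a]/(_ * rho a) -rmorphM.
Qed.

Definition from_ind : {linear Ind N -> scarrier X} :=
  pmod_lift_linear tensor_eval_sound.

Lemma from_ind_tensor a v : from_ind (tensor a v) = rho a *m ket vac v.
Proof. exact: (pmod_lift_gen tensor_eval_sound). Qed.

Definition basis_tensor (k : 'I_D) : Ind N :=
  tensor (cword K (occ_seq (enum_val (mxtens_unindex k).1)))
         (delta_mx (mxtens_unindex k).2 0 : N).

Definition to_ind (w : scarrier X) : Ind N :=
  \sum_k hk K n ((w : 'cV[K]_D) k 0) *: basis_tensor k.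

Lemma from_ind_basis k : from_ind (basis_tensor k) = delta_mx k 0 :> 'cV[K]_D.
Proof.
case: (mxtens_indexP k) => k0 k1; rewrite from_ind_tensor mxtens_indexK /=.
rewrite cword_ket ?occ_seq_sorted // occ_seqK /ket enum_valK.
apply/matrixP => s t; case: (mxtens_indexP s) => s0 s1.
rewrite !mxE !ord1 !mxtens_indexK /= !eqxx !andbT -natrM mulnb.
by rewrite (can_eq (@mxtens_indexK _ _)) -pair_eqE.
Qed.

(** The independence half of freeness: [from_ind] sends the basis tensors to the standard basis. *)
Lemma to_indK : cancel to_ind from_ind.
Proof.
move=> w; rewrite /to_ind linear_sum.
rewrite [RHS](matrix_sum_delta (w : 'cV[K]_D)); apply: eq_bigr => k _.
rewrite linearZZ mxact_scale from_ind_basis ind_rho_const mul_scalar_mx.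
by rewrite big_ord1.
Qed.

Lemma to_indD u w : to_ind (u + w) = to_ind u + to_ind w.
Proof.
rewrite /to_ind -big_split; apply: eq_bigr => k _.
by rewrite mxE rmorphD scalerDl.
Qed.

Lemma to_indZ a w : to_ind (a *: (w : 'cV[K]_D)) = hk K n a *: to_ind w.
Proof.
rewrite /to_ind scaler_sumr; apply: eq_bigr => k _.
by rewrite mxE rmorphM scalerA.
Qed.

Definition spanned (x : Ind N) := exists w, to_ind w = x.

Lemma spanned0 : spanned 0.
Proof.
by exists 0; rewrite /to_ind big1 // => k _; rewrite mxE rmorph0 scale0r.
Qed.

Lemma spannedD x y : spanned x -> spanned y -> spanned (x + y).
Proof. by move=> [u <-] [w <-]; exists (u + w); rewrite to_indD. Qed.

Lemma spanned_hk a x : spanned x -> spanned (hk K n a *: x).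
Proof. by move=> [w <-]; exists (a *: (w : 'cV_D)); rewrite to_indZ. Qed.

Lemma spannedN x : spanned x -> spanned (- x).
Proof. by rewrite -scaleN1r -(rmorphN1 (hk K n)); apply: spanned_hk. Qed.

Lemma spanned_sum (I : Type) (r : seq I) (F : I -> Ind N) :
  (forall i, spanned (F i)) -> spanned (\sum_(i <- r) F i).
Proof.
move=> hF; elim: r => [|i r IH]; first by rewrite big_nil; apply: spanned0.
by rewrite big_cons; apply: spannedD.
Qed.

Lemma spanned_basis k : spanned (basis_tensor k).
Proof.
exists (delta_mx k 0); rewrite /to_ind (bigD1 k) //= mxE !eqxx rmorph1 scale1r.
by rewrite big1 ?addr0 // => l /negbTE lk; rewrite mxE lk rmorph0 scale0r.
Qed.

Lemma occK l : sorted (@ordlt n) l -> occ_seq (occ l) = l.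
Proof.
move=> hl; apply: (irr_sorted_eq (leT := @ordlt n)) => //.
- by move=> i j k; apply: ltn_trans.
- by move=> i; apply: ltnn.
- exact: occ_seq_sorted.
by move=> i; rewrite mem_filter mem_enum ffunE andbT.
Qed.

Lemma spanned_sorted_word l v :
  sorted (@ordlt n) l -> spanned (tensor (cword K l) v).
Proof.
move=> hl; have -> : v = \sum_b pconst _ ((v : 'cV[K]_d) b 0) *: (delta_mx b 0 : N).
  rewrite [LHS](matrix_sum_delta (v : 'cV[K]_d)); apply: eq_bigr => b _.
  rewrite big_ord1 mxact_scale -mul_scalar_mx; congr (_ *m _).
  exact/esym/(plift_const (@scalar_mx_central _ _) (H0_rep_sound hP)).
rewrite (big_morph _ (tensorDr _) (tensor0r _ _)); apply: spanned_sum => b.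
rewrite tensor_scalar; apply: spanned_hk.
have := spanned_basis (mxtens_index (enum_rank (occ l), b)).
by rewrite /basis_tensor mxtens_indexK /= enum_rankK occK.
Qed.

Lemma spanned_hc j x : spanned x -> spanned (hc K j *: x).
Proof.
move=> [w <-]; rewrite /to_ind scaler_sumr; apply: spanned_sum => k.
rewrite scalerA -hkC -scalerA; apply: spanned_hk; rewrite tensorZl.
set y := enum_val _; have [e [l [hl _ ->]]] := cword_insert K j (occ_seq_sorted y).
have -> : (-1) ^+ e = hk K n ((-1) ^+ e) by rewrite rmorphXn rmorphN1.
by rewrite -tensorZl; apply/spanned_hk/spanned_sorted_word.
Qed.

(** The generator is pushed to the right through the word, letter by letter. *)
Lemma spanned_hpi_word i l v : spanned (hpi K i *: tensor (cword K l) v).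
Proof.
have hw m : spanned (tensor (cword K m) v).
  elim: m => [|j m IH]; first exact: spanned_sorted_word.
  by rewrite /cword big_cons -tensorZl; apply: spanned_hc.
elim: l => [|j l IH].
  (* At the end of the word the generator crosses the tensor sign and acts on [v]. *)
  rewrite tensorZl /cword big_nil mulr1 -H0_HCl_gen -[H0_HCl _ _ _]mul1r.
  by rewrite tensor_bal -cword_nil; apply: spanned_sorted_word.
rewrite /cword big_cons -tensorZl scalerA -/(cword K l).
have [->|jl] := eqVneq j (lo i).
  by rewrite hpi_lo -scalerA; apply: spanned_hc.
have [->|jh] := eqVneq j (hi i); last first.
  by rewrite hpi_comm // -scalerA; apply: spanned_hc.
(* The term still containing [hpi] is covered by induction, the two lower ones by [hw]. *)
rewrite (cross_hi (hpi_hi K i)) !scalerDl scaleNr -scalerA.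
by apply: spannedD; [apply: spannedD|apply: spannedN]; apply: spanned_hc.
Qed.

Lemma spanned_scale a x : spanned x -> spanned (a *: x).
Proof.
elim/palg_ind: a x => [a|[i|j]|a b ha hb|a b ha hb] x hx.
- exact: spanned_hk.
- case: hx => w <-; rewrite /to_ind scaler_sumr; apply: spanned_sum => k.
  by rewrite scalerA -hkC -scalerA; apply/spanned_hk/spanned_hpi_word.
- exact: spanned_hc.
- by rewrite scalerDl; apply: spannedD; [apply: ha|apply: hb].
- by rewrite -scalerA; apply/ha/hb.
Qed.

(** The spanning half of freeness: a tensor of [a] and [v] is [a] applied to that of 1 and [v], and
    the span is stable under the algebra. *)
Lemma spanned_all x : spanned x.
Proof.
elim/pmod_ind: x => [[a v]||x y|a x]; last 3 first.
- exact: spanned0.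
- exact: spannedD.
- exact: spanned_scale.
rewrite -/(tensor a v) -[a]mulr1 -tensorZl; apply: spanned_scale.
by rewrite -cword_nil; apply: spanned_sorted_word.
Qed.

Lemma from_indK : cancel from_ind to_ind.
Proof. by move=> x; have [w <-] := spanned_all x; rewrite to_indK. Qed.

(** Linearity over the whole algebra is inherited from the inverse map [from_ind]. *)
Lemma to_ind_is_linear : linear to_ind.
Proof.
by move=> a u w; rewrite -[LHS]from_indK -[RHS]from_indK linearP !to_indK.
Qed.
End InducedModel.

(** * Classes in the Grothendieck group *)

Section GradedClass.
Variables (K : fieldType) (n : nat).

Definition sclass (X : smodule K n) : G0 K := mgen (@G0_rel K) (existT _ n X).

Lemma smodule_iso (X Y : smodule K n) (f : scarrier X -> scarrier Y) d :
  linear f -> bijective f -> has_deg d f ->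
  sclass X = sclass Y.
Proof.
move=> lf bf df.
pose f' : {linear scarrier X -> scarrier Y} :=
  HB.pack f (GRing.isLinear.Build _ (scarrier X) (scarrier Y) *:%R f lf).
exact: mpi_eq (mcong_rel (G0_iso (f := f') bf df)).
Qed.

Lemma smodule_exact (X Y Z : smodule K n) (f : scarrier X -> scarrier Y)
    (g : scarrier Y -> scarrier Z) :
  linear f -> linear g -> has_deg false f -> has_deg false g -> injective f ->
  (forall y, g y = 0 <-> exists x, f x = y) -> (forall z, exists y, g y = z) ->
  sclass Y = sclass X + sclass Z.
Proof.
move=> lf lg df dg injf ex sg.
pose f' : {linear scarrier X -> scarrier Y} :=
  HB.pack f (GRing.isLinear.Build _ (scarrier X) (scarrier Y) *:%R f lf).
pose g' : {linear scarrier Y -> scarrier Z} :=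
  HB.pack g (GRing.isLinear.Build _ (scarrier Y) (scarrier Z) *:%R g lg).
rewrite [RHS](_ : _ = madd (sclass X) (sclass Z)) // /sclass.
rewrite /mgen -mpiD.
exact: mpi_eq (mcong_rel (G0_exact (f := f') (g := g') df dg injf ex sg)).
Qed.

(** [graded_class] chooses some model; two models of the same graded module are isomorphic in degree
    0, so the choice is immaterial. *)
Lemma graded_class_model (M : lmodType (HCl K n)) (deg : bool -> M -> Prop)
    (X : smodule K n) :
  is_model deg X -> graded_class deg = sclass X.
Proof.
move=> hX; rewrite /graded_class; case: pselect => [h|[]]; last by exists X.
case: (cid h) => Y /= [f [f1 f1K fK1] df]; case: hX => g [g1 g1K gK1] dg.
apply: (@smodule_iso Y X (g1 \o f) false).
- by move=> a u v /=; apply: (can_inj g1K); rewrite gK1 !linearP !gK1.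
- by exists (f1 \o g) => x /=; rewrite ?gK1 ?fK1 ?f1K ?g1K.
- by move=> e v /df; rewrite addbF dg /= gK1.
Qed.
End GradedClass.

Section InducedClass.
Variables (K : fieldType) (n d : nat).
Hypothesis K2 : 2%:R != 0 :> K.
Variable P : 'I_n.-1 -> 'M[K]_d.
Hypothesis hP : H0_relations P.

Local Notation D := (#|occupation n| * d)%N.
Let N : lmodType (H0 K n) := mxmod (H0_rep hP).
Local Notation X := (ind_smodule K2 hP).
Local Notation rho := (ind_rho K2 hP).

(** The vacuum is even, so an element of degree [e] applied to it yields degree [e]. *)
Lemma vdeg_from_ind e x : Ind_deg e x -> @vdeg K n X e (from_ind K2 hP x).
Proof.
case=> s hs ->; rewrite linear_sum.
elim: s hs => [|t s IH] hs; first by rewrite big_nil => k; rewrite mxE eqxx.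
have {}IH := IH (fun t' h => hs t' (mem_behead (s := t :: s) h)).
rewrite big_cons => k; rewrite mxE; set u := (X in _ + X).
have [->|/IH //] := eqVneq u 0; rewrite addr0 from_ind_tensor.
move=> /mulmx_support[l /andP[/(ind_rho_homog (hs t (mem_head _ _))) kl lv]].
rewrite [LHS]kl -[RHS]addbF; congr (_ (+) _); move: lv.
case: (mxtens_indexP l) => l0 l1; rewrite !mxE mxtens_indexK /= andbT.
case: (eqVneq l0 _) => [->|_]; last by rewrite mul0r eqxx.
by rewrite /ind_deg mxtens_indexK enum_rankK parity_vacuum.
Qed.

Lemma parityE (x : occupation n) : parity x = \big[addb/false]_(j <- occ_seq x) true.
Proof.
rewrite /occ_seq big_filter big_enum_cond /parity [RHS]big_mkcond /=.
by apply: eq_bigr => j _; case: (x j).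
Qed.

Lemma Ind_deg_to_ind e w : @vdeg K n X e w -> Ind_deg e (to_ind (hP := hP) w).
Proof.
move=> hw.
(* Zero coordinates are omitted: their basis tensors may have the wrong degree, and every listed
   term must have degree [e]. *)
exists [seq (hk K n ((w : 'cV[K]_D) k 0) *
             cword K (occ_seq (enum_val (mxtens_unindex k).1)),
             delta_mx (mxtens_unindex k).2 0 : N)
       | k <- enum 'I_D & (w : 'cV[K]_D) k 0 != 0].
  move=> t /mapP[k]; rewrite mem_filter => /andP[wk _] ->.
  have := hw k wk; rewrite /= /ind_deg parityE => <-.
  exact: homog_mul (homog_const _ _) (homog_cword _ _).
rewrite big_map big_filter big_enum_cond /= /to_ind [RHS]big_mkcond /=.
apply: eq_bigr => k _; case: eqP => [->|_] /=; first by rewrite rmorph0 scale0r.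
by rewrite -tensorZl.
Qed.

Lemma Ind_model : is_model (@Ind_deg K n N) X.
Proof.
pose f : {linear scarrier X -> Ind N} :=
  HB.pack (@to_ind K n d K2 P hP)
   (GRing.isLinear.Build _ (scarrier X) (Ind N) *:%R _
      (to_ind_is_linear (hP := hP))).
exists f; first by exists (from_ind K2 hP); [exact: to_indK|exact: from_indK].
move=> e w; split; first exact: Ind_deg_to_ind.
by move=> h; have := @vdeg_from_ind e (to_ind w) h; rewrite to_indK.
Qed.

Lemma Ind_classE : Ind_class N = sclass X.
Proof. exact: graded_class_model Ind_model. Qed.
End InducedClass.

(** * Functoriality and exactness of induction *)

Section Intertwiners.
Variables (K : comNzRingType) (m m' : nat) (M : 'M[K]_(m, m')).
Implicit Types (x : 'M[K]_m) (y : 'M[K]_m').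

Definition intertwines x y := x *m M = M *m y.

Lemma intertwines_scalar a : intertwines a%:M a%:M.
Proof. by rewrite /intertwines mul_scalar_mx mul_mx_scalar. Qed.

Lemma intertwinesD x x' y y' : intertwines x y -> intertwines x' y' ->
  intertwines (x + x') (y + y').
Proof. by rewrite /intertwines mulmxDl mulmxDr => -> ->. Qed.

Lemma intertwinesN x y : intertwines x y -> intertwines (- x) (- y).
Proof. by rewrite /intertwines mulNmx mulmxN => ->. Qed.

Lemma intertwinesM x x' y y' : intertwines x y -> intertwines x' y' ->
  intertwines (x * x') (y * y').
Proof. by rewrite /intertwines => xy x'y'; rewrite -mulmxA x'y' !mulmxA xy. Qed.
End Intertwiners.

Section Functoriality.
Variables (K : fieldType) (n d d' : nat).
Hypothesis K2 : 2%:R != 0 :> K.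
Variables (P : 'I_n.-1 -> 'M[K]_d) (P' : 'I_n.-1 -> 'M[K]_d').
Hypotheses (hP : H0_relations P) (hP' : H0_relations P').
Variable M : 'M[K]_(d', d).
Hypothesis hM : forall i, intertwines M (P' i) (P i).

Definition ind_map : 'M[K]_(#|occupation n| * d', #|occupation n| * d) :=
  1%:M *t M.

Lemma ind_map_cl b j : intertwines ind_map (ind_cl K d' b j) (ind_cl K d b j).
Proof. by rewrite /intertwines /ind_map /ind_cl !tensmx_mul !mul1mx !mulmx1. Qed.

Lemma ind_map_p i : intertwines ind_map (ind_p P' i) (ind_p P i).
Proof. by rewrite /intertwines /ind_map /ind_p !tensmx_mul !mul1mx hM. Qed.

(** [ind_pi] is a fixed polynomial in scalars, Clifford operators and [ind_p], each of which is
    intertwined. *)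
Lemma ind_map_pi i : intertwines ind_map (ind_pi P' i) (ind_pi P i).
Proof.
have h1 : intertwines ind_map 1 1 := intertwines_scalar ind_map 1.
have hB b j k : intertwines ind_map (ind_cl K d' b j - ind_cl K d' b k)
                                    (ind_cl K d b j - ind_cl K d b k).
  by apply: intertwinesD; last apply: intertwinesN; apply: ind_map_cl.
have hC b j k : intertwines ind_map (ind_cl K d' b j * ind_cl K d' b k)
                                    (ind_cl K d b j * ind_cl K d b k).
  by apply: intertwinesM; apply: ind_map_cl.
have hs := intertwines_scalar ind_map (2%:R^-1).
rewrite /ind_pi /hecke_pi /cswap; apply: intertwinesD.
  apply: intertwinesM.
    apply: intertwinesN; apply: intertwinesM => //.
    by apply: intertwinesM; apply: hB.
  apply: intertwinesD; first exact: ind_map_p.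
  by apply: intertwinesM => //; apply: intertwinesD => //; apply: intertwinesN.
by apply: intertwinesN; apply: intertwinesM => //; apply: intertwinesD.
Qed.

Lemma ind_map_rho a : intertwines ind_map (ind_rho K2 hP' a) (ind_rho K2 hP a).
Proof.
elim/palg_ind: a => [a|[i|j]|a b ha hb|a b ha hb].
- by rewrite !ind_rho_const; apply: intertwines_scalar.
- by rewrite !ind_rho_pi; apply: ind_map_pi.
- by rewrite !ind_rho_c; apply: ind_map_cl.
- by rewrite !rmorphD; apply: intertwinesD.
- by rewrite !rmorphM; apply: intertwinesM.
Qed.

Definition ind_hom (v : scarrier (ind_smodule K2 hP)) :
  scarrier (ind_smodule K2 hP') := ind_map *m (v : 'cV_(_ * _)).

Lemma ind_hom_linear : linear ind_hom.
Proof.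
move=> a u v; rewrite /ind_hom mulmxDr; congr (_ + _).
by rewrite !mxact_scale !mulmxA; congr (_ *m _); rewrite -ind_map_rho.
Qed.

Lemma ind_hom_deg : has_deg false ind_hom.
Proof.
move=> e v hv k /mulmx_support[l /andP[+ /hv <-]]; rewrite addbF.
case: (mxtens_indexP k) => k0 k1; case: (mxtens_indexP l) => l0 l1.
rewrite tensmxE /= /ind_deg !mxtens_indexK /= !mxE.
by case: (eqVneq k0 l0) => [->|_] //; rewrite mul0r eqxx.
Qed.
End Functoriality.

Section SplitSequence.
Variables (K : fieldType) (n d d1 d2 : nat).
Hypothesis K2 : 2%:R != 0 :> K.
Variables (P : 'I_n.-1 -> 'M[K]_d) (P1 : 'I_n.-1 -> 'M[K]_d1).
Hypotheses (hP : H0_relations P) (hP1 : H0_relations P1).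
Variables (f : 'M[K]_(d, d1)) (f' : 'M[K]_(d1, d)).
Variables (g : 'M[K]_(d2, d)) (g' : 'M[K]_(d, d2)).
Hypotheses (f'f : f' *m f = 1%:M) (gg' : g *m g' = 1%:M) (gf : g *m f = 0).
Hypothesis fg : f *m f' + g' *m g = 1%:M.
Hypothesis Pf : forall i, intertwines f (P i) (P1 i).

(** The action on the quotient by the image of [f], read through the linear section [g']; the
    splitting is one of vector spaces. *)
Definition quotient_mx i : 'M[K]_d2 := g *m P i *m g'.

(** In [g P (f f' + g' g)] the first part vanishes, since [g P f = g f P1 = 0]. *)
Lemma quotient_mx_intertwines i : intertwines g (quotient_mx i) (P i).
Proof.
rewrite /intertwines -[RHS]mulmx1 -fg mulmxDr [X in X + _]mulmxA.
by rewrite -[g *m _ *m f]mulmxA Pf !mulmxA gf !mul0mx add0r.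
Qed.

Lemma quotient_mx_relations : H0_relations quotient_mx.
Proof.
have [h1 h2 h3] := hP.
have key x x' y y' : intertwines g x x' -> intertwines g y y' -> x' = y' -> x = y.
  by move=> hx hy xy; rewrite -[x]mulmx1 -[y]mulmx1 -gg' !mulmxA hx hy xy.
have hq := quotient_mx_intertwines; split=> [i|i j ij|i j ij].
- apply: key (h1 i); [exact: intertwinesM|exact: intertwinesN].
- by apply: key (h2 i j ij); apply: intertwinesM.
- by apply: key (h3 i j ij); do 2?apply: intertwinesM.
Qed.

(** Tensoring the linear splitting with the identity of the Clifford algebra splits the induced
    sequence, which is therefore exact. *)
Lemma Ind_class_split :
  Ind_class (mxmod (H0_rep hP)) =
  Ind_class (mxmod (H0_rep hP1)) + Ind_class (mxmod (H0_rep quotient_mx_relations)).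
Proof.
rewrite !(Ind_classE K2).
apply: (@smodule_exact _ _ _ _ _ (@ind_hom _ _ _ _ K2 P1 P hP1 hP f)
  (@ind_hom _ _ _ _ K2 P quotient_mx hP quotient_mx_relations g)).
- exact: ind_hom_linear.
- exact: ind_hom_linear quotient_mx_intertwines.
- exact: ind_hom_deg.
- exact: ind_hom_deg.
- apply: (can_inj (g := fun v : 'cV_(_ * _) => ind_map n f' *m v)) => v.
  by rewrite /ind_hom mulmxA /ind_map tensmx_mul mul1mx f'f tensmx1 mul1mx.
- move=> y; split=> [gy|[x <-]]; last first.
    by rewrite /ind_hom mulmxA /ind_map tensmx_mul mul1mx gf tensmx0 mul0mx.
  exists (ind_map n f' *m (y : 'cV_(_ * _))).
  rewrite -[RHS]mul1mx -tensmx1 -fg /ind_hom mulmxA /ind_map tensmx_mul mul1mx.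
  have -> : (1%:M : 'M[K]_#|occupation n|) *t (f *m f' + g' *m g) =
            1%:M *t (f *m f') + (1%:M *t g') *m (1%:M *t g).
    by rewrite tensmx_mul mul1mx; apply/matrixP => i j; rewrite !mxE mulrDr.
  rewrite mulmxDl -[X in _ = _ + X]mulmxA.
  by move: gy; rewrite /ind_hom /ind_map => ->; rewrite mulmx0 addr0.
- move=> z; exists (ind_map n g' *m (z : 'cV_(_ * _))).
  by rewrite /ind_hom mulmxA /ind_map tensmx_mul mul1mx gg' tensmx1 mul1mx.
Qed.
End SplitSequence.

(** * Filtration of triangular modules *)

Lemma Ind_class_dim0 (K : fieldType) n (P : 'I_n.-1 -> 'M[K]_0)
    (hP : H0_relations P) : 2%:R != 0 :> K -> Ind_class (mxmod (H0_rep hP)) = 0.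
Proof.
move=> K2; rewrite (Ind_classE K2); set X := ind_smodule K2 hP.
have all0 (v : scarrier X) : v = 0.
  by apply/matrixP => i j; case: (mxtens_unindex (i : 'I_(_ * 0))).2.
have hid : linear (fun v : scarrier X => v) by [].
have hdeg : has_deg false (fun v : scarrier X => v).
  by move=> e v; rewrite addbF.
(* On the zero module two identity maps form a short exact sequence, so its class equals twice
   itself. *)
have E := smodule_exact hid hid hdeg hdeg (fun x y h => h).
apply: (addrI (sclass X)); rewrite addr0 -{}E //.
  by move=> y; rewrite (all0 y); split=> // _; exists 0.
by move=> z; exists z.
Qed.

(** Induction on the dimension, splitting off one basis vector that spans a submodule. *)
Lemma Ind_class_triangular (K : fieldType) n d (P : 'I_n.-1 -> 'M[K]_d)
    (hP : H0_relations P) (l : 'I_d -> nat) (D : 'I_d -> seq nat) :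
    2%:R != 0 :> K ->
    (forall i b, P i b b = if i.+1 \in Des (D b) then -1 else 0) ->
    (forall i a b, a != b -> P i a b != 0 -> (l a < l b)%N) ->
  Ind_class (mxmod (H0_rep hP)) = \sum_b Ind_class (F_mod K n (D b)).
Proof.
move=> K2; elim: d P hP l D => [|d IH] P hP l D hD hl.
  by rewrite big_ord0 Ind_class_dim0.
(* At least level, column [b] of every [P i] is zero off the diagonal, so its basis vector spans a
   copy of the simple module of [D b]. *)
have [b _ hb] := @arg_minnP _ ord0 xpredT l isT.
pose f : 'M[K]_(d.+1, 1) := delta_mx b 0; pose f' : 'M[K]_(1, d.+1) := delta_mx 0 b.
pose g : 'M[K]_(d, d.+1) := rowsub (lift b) 1%:M.
pose g' : 'M[K]_(d.+1, d) := colsub (lift b) 1%:M.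
have f'f : f' *m f = 1%:M.
  by rewrite mul_delta_mx; apply/matrixP => i j; rewrite !ord1 !mxE eqxx.
have gg' : g *m g' = 1%:M.
  rewrite -rowsubE; apply/matrixP => i j.
  by rewrite !mxE (inj_eq lift_inj).
have gf : g *m f = 0.
  rewrite -rowsubE; apply/matrixP => i j; rewrite !mxE.
  by rewrite eq_sym (negbTE (neq_lift _ _)).
have fg : f *m f' + g' *m g = 1%:M.
  rewrite mul_delta_mx; apply/matrixP => s t; rewrite !mxE.
  case: (unliftP b s) => [k ->|->]; last first.
    rewrite eqxx big1 ?addr0 1?eq_sym // => k _.
    by rewrite !mxE (negbTE (neq_lift _ _)) mul0r.
  rewrite [lift b k == b]eq_sym (negbTE (neq_lift _ _)) add0r (bigD1 k) //=.
  rewrite !mxE eqxx mul1r big1 ?addr0 // => m mk.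
  by rewrite !mxE (inj_eq lift_inj) eq_sym (negbTE mk) mul0r.
have Pf i : intertwines f (P i) (F_mx K (D b) i).
  rewrite /intertwines -colE; apply/matrixP => s t; rewrite !ord1 !mxE big_ord1 !mxE.
  rewrite eqxx andbT mulr1n; have [->|sb] := eqVneq s b; first by rewrite hD mul1r.
  rewrite mul0r; apply/eqP; apply: contraTT (hb s isT) => Pi.
  by rewrite -ltnNge (hl i).
rewrite (Ind_class_split K2 hP (F_mx_relations K n (D b)) f'f gg' gf fg Pf).
rewrite (bigD1_ord b) //=; congr (_ + _).
(* The quotient deletes row and column [b], which preserves triangularity. *)
have qE i s t : quotient_mx P g g' i s t = P i (lift b s) (lift b t).
  by rewrite /quotient_mx -rowsubE mulmx_colsub mulmx1 !mxE.
apply: (IH _ _ (fun k => l (lift b k)) (fun k => D (lift b k))).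
  by move=> i k; rewrite qE hD.
by move=> i s t st; rewrite qE => /hl; apply; rewrite (inj_eq lift_inj).
Qed.

Theorem theorem4p7 (R : realType) (n : nat) (alpha : seq nat)
    (Halpha : is_peak_comp n alpha)
    (ch : {linear G0 R[i] -> fps R[i]}) (Hch : peak_characteristic ch) :
  ch (Ind_class (N_mod R[i] (SPCT_ascent_compatible Halpha))) =
    Qtilde R[i] n alpha.
Proof.
pose Ts := SPCT n alpha; pose T (b : 'I_#|Ts|) : 'S_n := enum_val b.
have two : 2%:R != 0 :> R[i] by rewrite Num.Theory.pnatr_eq0.
rewrite /N_mod (@Ind_class_triangular _ _ _ _ _ (fun b => \sum_(r < n) r * T b r)%N
  (fun b => comp_of_set n (DesT (T b))) two).
- rewrite linear_sum /Qtilde [RHS]big_enum_val; apply: eq_bigr => b _.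
  by rewrite (ch_induced Hch) ?comp_of_set_comp // Des_comp_of_DesT.
- move=> i b; rewrite Des_comp_of_DesT mxE /= -/(T b) eqxx.
  (* A nonattacking ascent gives a zero diagonal entry: the exchange reverses the descent at [i], so
     it cannot fix the filling. *)
  case: ifP => // _; case: ifP => // _; case: eqP => // /(congr1 (dsc i)).
  by rewrite dsc_swap; case: (dsc _ _).
(* Off the diagonal, only a nonattacking ascent gives a nonzero entry, and then [T a] is the
   exchanged filling, of smaller weight. *)
move=> i a b ab; rewrite mxE /= -/(T a) -/(T b) (inj_eq enum_val_inj) (negbTE ab).
rewrite oppr0 DesTE; case: ifPn => [_|hd]; first by rewrite eqxx.
case: ifP => _; first by rewrite eqxx.
by case: (T a =P _) => [->|_]; [move=> _; exact: swap_weight | rewrite eqxx].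
Qed.
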